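(* Let $\alpha > 0$, $a < T$, let $y_0, \ldots, y_{\lceil\alpha\rceil-1} \in \mathbb{R}$, and let $f : [a,T]\times\mathbb{R} \to \mathbb{R}$ be continuous and bounded and satisfy a Lipschitz condition with respect to the second variable, i.e. there is $L \ge 0$ with $|f(t,u)-f(t,v)| \le L|u-v|$ for all $t\in[a,T]$ and $u,v\in\mathbb{R}$. Let $y$ be the solution on $[a,T]$ of the initial value problem $$D_{*a}^{\alpha} y(t) = f(t,y(t)), \qquad y^{(k)}(a) = y_k \quad (k=0,1,\ldots,\lceil\alpha\rceil-1),$$ and, for $\tilde a$ with $a \le \tilde a < T$, let $\tilde y$ be the solution on $[\tilde a, T]$ of the initial value problem $$D_{*\tilde a}^{\alpha} \tilde y(t) = f(t,\tilde y(t)), \qquad \tilde y^{(k)}(\tilde a) = y_k \quad (k=0,1,\ldots,\lceil\alpha\rceil-1).$$ Then $$\sup_{t\in[\tilde a,T]} |y(t)-\tilde y(t)| = O\bigl(|a-\tilde a|^{\min\{\alpha,1\}}\bigr),$$ i.e. there is a constant $C$, depending on $\alpha, a, T, f, y_0,\ldots,y_{\lceil\alpha\rceil-1}$ but not on $\tilde a$, such that $\sup_{t\in[\tilde a,T]} |y(t)-\tilde y(t)| \le C|a-\tilde a|^{\min\{\alpha,1\}}$ for all $\tilde a \in [a,T)$.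
   Context: For $b<T$ and $\beta > 0$, the Riemann-Liouville integral is $J_b^{\beta} g(t) = \frac{1}{\Gamma(\beta)}\int_b^t (t-s)^{\beta-1} g(s)\,ds$, and $J_b^0$ is the identity. For $\alpha>0$ and $m=\lceil\alpha\rceil$, the Caputo differential operator of order $\alpha$ with starting point $b$ is $$D_{*b}^{\alpha} y(t) = \frac{d^m}{dt^m} J_b^{m-\alpha}\Bigl[y - \sum_{k=0}^{m-1}\frac{y^{(k)}(b)}{k!}(\cdot-b)^k\Bigr](t).$$ A solution of the initial value problem $D_{*b}^{\alpha} y(t) = f(t,y(t))$, $y^{(k)}(b)=y_k$ ($k=0,\ldots,m-1$), on $[b,T]$ is a function $y\in C^{m-1}[b,T]$ satisfying the initial conditions and satisfying the differential equation on $(b,T]$. It is well known that, for continuous $f$, this problem is equivalent to the Volterra integral equation $$y(t) = \sum_{k=0}^{m-1}\frac{y_k}{k!}(t-b)^k + \frac{1}{\Gamma(\alpha)}\int_b^t (t-s)^{\alpha-1} f(s,y(s))\,ds, \quad t\in[b,T],$$ for continuous $y$, and that, for $f$ continuous, bounded and Lipschitz in the second variable, there is a unique continuous solution on $[b,T]$. *)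

(* Defs.v *)
From HB Require Import structures.
From mathcomp Require Export all_boot all_order all_algebra.
From mathcomp Require Export all_classical all_reals all_analysis.
Export Order.TTheory GRing.Theory Num.Theory.
Export numFieldNormedType.Exports.

Set Implicit Arguments.
Unset Strict Implicit.
Unset Printing Implicit Defensive.

Local Open Scope classical_set_scope.
Local Open Scope ring_scope.

(* The Euler integral; only used at positive arguments, where it converges. *)
Definition Gamma {R : realType} (x : R) : R :=
  \int[lebesgue_measure]_(s in `]0, +oo[) (s `^ (x - 1) * expR (- s)).

(* Derivatives relative to a set A: on a closed interval they are two-sided
   at interior points and one-sided at the endpoints. *)
Definition derivable_within {R : realType} (A : set R) (g : R -> R) (x : R)
    : Prop :=
  cvg ((fun z => (g z - g x) / (z - x)) @ within A x^').

Definition derive_within {R : realType} (A : set R) (g : R -> R) (x : R) : R :=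
  lim ((fun z => (g z - g x) / (z - x)) @ within A x^').

Definition derive_within_n {R : realType} (A : set R) (n : nat) (g : R -> R)
    : R -> R :=
  iter n (derive_within A) g.

(* The lower-order derivatives are automatically continuous on A, being
   derivable there. *)
Definition Cn_on {R : realType} (A : set R) (n : nat) (g : R -> R) : Prop :=
  (forall (k : nat) (x : R),
      (k < n)%N -> A x -> derivable_within A (derive_within_n A k g) x) /\
  {within A, continuous (derive_within_n A n g)}.

(* The singularity of the kernel at s = t is a null set. *)
Definition riemann_liouville {R : realType} (b beta : R) (g : R -> R) (t : R)
    : R :=
  if beta == 0 then g t
  else (Gamma beta)^-1 *
       \int[lebesgue_measure]_(s in `[b, t]) ((t - s) `^ (beta - 1) * g s).

Definition caputo_order {R : realType} (alpha : R) : nat :=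
  `|Num.ceil alpha|%N.

Definition taylor_poly {R : realType} (b T : R) (m : nat) (y : R -> R) (t : R)
    : R :=
  \sum_(k < m) derive_within_n `[b, T] k y b / k`!%:R * (t - b) ^+ k.

(* J_b^(m - alpha) [y - Taylor polynomial of y at b], the function whose m-th
   derivative is the Caputo derivative. *)
Definition caputo_primitive {R : realType} (alpha b T : R) (y : R -> R)
    : R -> R :=
  let m := caputo_order alpha in
  riemann_liouville b (m%:R - alpha) (fun s => y s - taylor_poly b T m y s).

Definition caputo {R : realType} (alpha b T : R) (y : R -> R) : R -> R :=
  derive_within_n `[b, T] (caputo_order alpha) (caputo_primitive alpha b T y).

Definition caputo_derivable {R : realType} (alpha b T : R) (y : R -> R) (t : R)
    : Prop :=
  forall k : nat, (k < caputo_order alpha)%N ->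
    derivable_within `[b, T]
      (derive_within_n `[b, T] k (caputo_primitive alpha b T y)) t.

(* y is a solution on [b, T]; only its values on [b, T] matter. *)
Definition caputo_ivp_solution {R : realType} (alpha : R) (f : R -> R -> R)
    (y0 : 'I_(caputo_order alpha) -> R) (b T : R) (y : R -> R) : Prop :=
  [/\ Cn_on `[b, T] (caputo_order alpha).-1 y,
      (forall k : 'I_(caputo_order alpha),
          derive_within_n `[b, T] k y b = y0 k) &
      forall t : R, t \in `]b, T] ->
        caputo_derivable alpha b T y t /\ caputo alpha b T y t = f t (y t)].

(* Main.v *)
Require Import Defs.
From HB Require Import structures.
From mathcomp Require Import ring lra.
From mathcomp Require Import measurable_realfun interval_inference.

(** Write rl(p, b, G)(t) for the integral of (t - s)^(p-1) G(s) over [b, t],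
that is Gamma(p) times the Riemann-Liouville integral of order p.

The first half of the proof turns each initial value problem into a Volterra
equation y = (Taylor polynomial at b) + kappa rl(alpha, b, F), where
F(t) = f(t, y(t)) and kappa > 0 depends on alpha only [caputo_volterra].
Let m = ceil(alpha), beta = m - alpha, and let g be y minus its Taylor
polynomial.  The m-th derivative of w = J^beta g is F on (b, T], so w differs
there from the m-fold iterated integral of F by a polynomial of degree < m in
t - b [antiderivative_repr].  As y is C^(m-1), both w and the iterated integral
are o((t - b)^(m-1)) at b, and a polynomial of degree < m with this property
vanishes [poly_flat_eq0].  For integer alpha this is already the Volterra
equation.  Otherwise one applies rl(1 - beta) to both sides.  By the semigroup
law rl(p) rl(q) = B(p, q) rl(p + q) [rlint_semigroup], the left side becomes a
multiple of the integral of g and the right side a multiple of the integral of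
rl(alpha, b, F); both integrands are continuous, hence they are proportional.
The factor kappa is an expression in the values of B and Gamma, which are
finite and positive [Beta_gt0, Gamma_gt0].

The second half compares the two Volterra equations on [a', T].  The Taylor
polynomials at a and at a' have the same coefficients, so they differ by
O(a' - a); the part of rl(alpha, a, F) that comes from [a, a'] is
O((a' - a)^min(alpha, 1)) because f is bounded [rlint_start_diff]; what remains
is at most kappa L rl(alpha, a', |y - y'|) by the Lipschitz condition.  A
Gronwall inequality with the singular kernel (t - s)^(alpha-1) concludes
[gronwall]: after multiplication by exp(-lambda t) with lambda large, the
integral operator has norm at most 1/2 in the sup norm. *)

Set Implicit Arguments.
Unset Strict Implicit.
Unset Printing Implicit Defensive.

Local Open Scope classical_set_scope.
Local Open Scope ring_scope.

(** * Affine changes of variable *)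

Section AffineSubstitution.
Context {R : realType}.
Local Notation mu := (@lebesgue_measure R).
Local Open Scope ereal_scope.

(** The image of Lebesgue measure under x |-> c x + d, scaled by c, agrees with
Lebesgue measure on half-open intervals, hence everywhere.  As f is merely
measurable, it may be a kernel with a singularity. *)
Lemma ge0_integral_affine (c d : R) (f : R -> \bar R) : (0 < c)%R ->
  measurable_fun [set: R] f -> (forall x, 0 <= f x) ->
  \int[mu]_x f x = c%:E * \int[mu]_x f (c * x + d)%R.
Proof.
move=> c0 mf f0.
pose phi : measurableTypeR R -> measurableTypeR R := fun x => (c * x + d)%R.
have mphi : measurable_fun setT phi.
  by apply: measurable_funD => //; apply: measurable_funM.
pose phim : {mfun measurableTypeR R >-> measurableTypeR R} :=
  HB.pack phi (isMeasurableFun.Build _ _ _ _ _ mphi).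
have cn : (0 <= c)%R := ltW c0.
have E A : measurable A -> mu A = mscale (NngNum cn) (pushforward mu phim) A.
  apply: lebesgue_measure_unique => X [[a b]] _ <-.
  have E : phi @^-1` `]a, b]%classic = `]((a - d) / c)%R, ((b - d) / c)%R]%classic.
    apply/seteqP; split=> x /=; rewrite !in_itv/= ltr_pdivrMr// ler_pdivlMr//;
      by rewrite (mulrC x) ltrBlDr lerBrDr.
  transitivity (c%:E * mu `]((a - d) / c)%R, ((b - d) / c)%R]); last by rewrite -E.
  rewrite !lebesgue_measure_itv/= !lte_fin ltr_pM2r ?invr_gt0// ltrD2r.
  case: ifP => _; last by rewrite mule0.
  by rewrite -!EFinD -EFinM; congr EFin; field; rewrite gt_eqF.
rewrite (eq_measure_integral (mscale (NngNum cn) (pushforward mu phim))); last first.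
  by move=> A mA _; exact: E.
rewrite ge0_integral_mscale//=; congr (_ * _).
by rewrite ge0_integral_pushforward.
Qed.

Lemma ge0_integral_reflect (d : R) (f : R -> \bar R) :
  measurable_fun [set: R] f -> (forall x, 0 <= f x) ->
  \int[mu]_x f x = \int[mu]_x f (d - x)%R.
Proof.
move=> mf f0.
rewrite (@ge0_integral_affine 1 d f)// mul1e.
pose g x := f (1 * x + d)%R.
have mg : measurable_fun setT g.
  apply: measurableT_comp => //.
  by apply: measurable_funD => //; apply: measurable_funM.
transitivity (\int[pushforward mu (-%R : _ -> measurableTypeR R)]_x g x).
  apply: eq_measure_integral => A mA _; exact/esym/lebesgue_measureN.
rewrite ge0_integral_pushforward//=; last by move=> y _; exact: f0.
by apply: eq_integral => x _; rewrite /g/=; congr f; ring.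
Qed.

Lemma integral_gt0 (D : set R) (f : R -> \bar R) : measurable D ->
  measurable_fun D f -> (forall x, D x -> 0 < f x) -> 0 < mu D ->
  0 < \int[mu]_(x in D) f x.
Proof.
move=> mD mf f0 D0.
rewrite lt_neqAle integral_ge0 ?andbT; last by move=> x /f0/ltW.
apply/eqP => I0.
have /(ae_eq_integral_abs mu mD mf)[N [mN N0 DN]] :
    \int[mu]_(x in D) `|f x| = 0.
  by rewrite I0; apply: eq_integral => x /set_mem /f0/ltW/gee0_abs.
suff : mu D <= mu N by rewrite N0 leNgt D0.
apply: le_measure; rewrite ?inE// => x Dx; apply: DN => /= /(_ Dx) fx0.
by have := f0 _ Dx; rewrite fx0 ltxx.
Qed.

End AffineSubstitution.

(** * Integrals of powers *)

Section TruncatedPower.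
Context {R : realType}.
Local Notation mu := (@lebesgue_measure R).

(** The kernel x^(p-1) cut off at 0.  With it every integral over [b, t] becomes
a convolution over the whole line, where Tonelli's theorem and affine
substitutions need no care about bounds. *)
Definition tpow (p x : R) : R := if 0 < x then x `^ (p - 1) else 0.

Lemma tpow_ge0 p x : 0 <= tpow p x.
Proof. by rewrite /tpow; case: ifP => // _; exact: powR_ge0. Qed.

Lemma measurable_tpow p : measurable_fun [set: R] (tpow p).
Proof.
have -> : tpow p = (fun x => x `^ (p - 1)) \_ `]0, +oo[.
  by apply/funext => x; rewrite patchE mem_setE in_itv/= andbT.
apply/(measurable_restrictT (fun x => x `^ (p - 1))) => //.
apply: measurable_funTS; exact: measurable_powR.
Qed.

Lemma tpowM p c x : 0 < c -> tpow p (c * x) = c `^ (p - 1) * tpow p x.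
Proof.
move=> c0; rewrite /tpow pmulr_rgt0//; case: ifP => x0; last by rewrite mulr0.
by rewrite powRM// ltW.
Qed.

(** For p < 1 the integrand is unbounded at 0: the fundamental theorem of
calculus is applied on [h / (n + 2), h] and monotone convergence does the
rest. *)
Lemma integral_powR (p h : R) : 0 < p -> 0 <= h ->
  (\int[mu]_(x in `]0%R, h]) (x `^ (p - 1))%:E = (h `^ p / p)%:E)%E.
Proof.
move=> p0; rewrite le_eqVlt => /predU1P[<-|h0].
  by rewrite set_itvoc0 integral_set0 powR0 ?mul0r// gt_eqF.
pose u n : R := h / n.+2%:R.
have u0 n : 0 < u n by rewrite divr_gt0.
have uh n : u n < h by rewrite ltr_pdivrMr// ltr_pMr// ltr1n.
have cu : u @ \oo --> 0^'+.
  have c : u @ \oo --> 0.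
    rewrite -[0](mulr0 h); apply: cvgMr.
    have := @cvg_harmonic R; rewrite -cvg_shiftS; exact.
  move=> A AA; have [N _ HN] := c _ AA; exists N => // n Nn.
  by apply: (HN n Nn); exact: u0.
have U : `]0, h]%classic = \bigcup_n `[u n, h]%classic.
  apply/seteqP; split=> [x /=|x [n _]] /=; rewrite !in_itv/= => /andP[x0 xh].
    have : \forall n \near \oo, u n < x.
      have := cu _ (nbhs_right_lt x0); exact.
    case=> n _ /(_ n (leqnn n)) /= unx.
    by exists n => //=; rewrite in_itv/= (ltW unx).
  by rewrite xh (lt_le_trans (u0 n)).
have I n : (\int[mu]_(x in `[u n, h]) (x `^ (p - 1))%:E =
    (h `^ p / p)%:E - ((u n) `^ p / p)%:E)%E.
  have D (x : R) : 0 < x -> is_derive x 1 (fun x : R => x `^ p / p) (x `^ (p - 1)).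
    move=> x0.
    have xin : x \in `]0, +oo[ by rewrite in_itv/= x0.
    have dx : derivable (fun x : R => x `^ p) x 1 by exact: derivable_powR.
    have : is_derive x 1 (fun x : R => x `^ p) (p * x `^ (p - 1)).
      by apply: DeriveDef => //; rewrite -derive1E powR_derive1.
    move=> ?; apply: is_derive_eq.
rewrite ?scaler0 /GRing.scale/= ?add0r ?addr0.
    by rewrite mulrA mulVf ?mul1r// gt_eqF.
  have C (x : R) : 0 < x -> {for x, continuous (fun x : R => x `^ p / p)}.
    by move=> /D [+ _] => /derivable1_diffP/differentiable_continuous.
  have C' (x : R) : 0 < x -> {for x, continuous (fun x : R => x `^ (p - 1))}.
    move=> x0; apply/differentiable_continuous/derivable1_diffP.
    by apply: derivable_powR; rewrite in_itv/= x0.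
  rewrite (@continuous_FTC2 _ _ (fun x => x `^ p / p))//.
  - apply: continuous_in_subspaceT => x; rewrite inE/= in_itv/= => /andP[ux _].
    by apply: C'; exact: lt_le_trans (u0 n) ux.
  - split.
    + move=> x; rewrite in_itv/= => /andP[ux _].
      by have [] := D _ (lt_trans (u0 n) ux).
    + by apply: cvg_at_right_filter; exact: C.
    + by apply: cvg_at_left_filter; exact: C.
  - move=> x; rewrite in_itv/= => /andP[ux _].
    by rewrite derive1E; have [_] := D _ (lt_trans (u0 n) ux).
have mf n : measurable_fun `[u n, h] (fun x : R => (x `^ (p - 1))%:E).
  apply/measurable_EFinP; apply: measurable_funTS; exact: measurable_powR.
have : (\int[mu]_(x in `[u n, h]) (x `^ (p - 1))%:E @[n --> \oo] -->
    \int[mu]_(x in \bigcup_n `[u n, h]%classic) (x `^ (p - 1))%:E)%E.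
  apply: ge0_nondecreasing_set_cvg_integral => //.
  - move=> m n mn; apply/subsetPset => x /=; rewrite !in_itv/= => /andP[ux ->].
    rewrite andbT (le_trans _ ux)// ler_pM2l// lef_pV2 ?posrE ?ltr0n//.
    by rewrite ler_nat !ltnS.
  - by move=> n x _; rewrite lee_fin powR_ge0.
rewrite -U; under eq_fun do rewrite I -EFinB.
move=> c; apply: (cvg_unique _ c) => //=.
apply: cvg_EFin; first by near=> n.
rewrite -[X in _ --> X]subr0; apply: cvgB; first exact: cvg_cst.
rewrite -[0](mul0r p^-1); apply: cvgMl.
exact: (cvg_comp _ _ cu (powR_cvg0 p0)).
Unshelve. all: by end_near. Qed.

Lemma integral_tpow (p h : R) : 0 < p -> 0 <= h ->
  (\int[mu]_(x in `]-oo, h]) (tpow p x)%:E = (h `^ p / p)%:E)%E.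
Proof.
move=> p0 h0; rewrite -integral_powR//.
rewrite integral_mkcond [RHS]integral_mkcond; apply: eq_integral => x _.
rewrite !patchE !mem_setE !in_itv/= /tpow.
by case: ltP => //= x0; case: ifP.
Qed.

End TruncatedPower.

(** * The Riemann-Liouville integral *)

Section RiemannLiouville.
Context {R : realType}.
Local Notation mu := (@lebesgue_measure R).

Lemma integral_reflect (d : R) (f : R -> \bar R) : measurable_fun [set: R] f ->
  (\int[mu]_x f x = \int[mu]_x f (d - x)%R)%E.
Proof.
move=> mf; rewrite integralE [RHS]integralE; congr (_ - _)%E.
  rewrite (ge0_integral_reflect d)//; first by rewrite unlock.
  exact: measurable_funepos.
rewrite (ge0_integral_reflect d)//; first by rewrite unlock.
exact: measurable_funeneg.
Qed.

(** Gamma(p) times the Riemann-Liouville integral of order p: with the factor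
1/Gamma(p) removed, only integrals of powers have to be computed. *)
Definition rlint (p b : R) (G : R -> R) (t : R) : R :=
  \int[mu]_(s in `[b, t]) ((t - s) `^ (p - 1) * G s).

Definition cut_below (b : R) (G : R -> R) : R -> R := G \_ `[b, +oo[.

Lemma measurable_cut_below b G : measurable_fun setT G ->
  measurable_fun setT (cut_below b G).
Proof.
by move=> mG; apply/(measurable_restrictT G) => //; exact: measurable_funTS.
Qed.

Lemma measurable_kernel p t :
  measurable_fun [set: R] (fun s : R => (t - s) `^ (p - 1)).
Proof.
apply: (measurableT_comp (f := @powR R ^~ (p - 1))); first exact: measurable_powR.
exact: measurable_funB.
Qed.

Lemma measurable_tpowB p t : measurable_fun [set: R] (fun s : R => tpow p (t - s)).
Proof.
apply: measurableT_comp; first exact: measurable_tpow.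
exact: measurable_funB.
Qed.

(** The two integrands differ only at s = t, where the left kernel is 0^(p-1)
and the right one 0. *)
Lemma integral_kernel_mkcond (p b t : R) (G : R -> R) : measurable_fun setT G ->
  (\int[mu]_(s in `[b, t]) ((t - s) `^ (p - 1) * G s)%:E =
   \int[mu]_s (tpow p (t - s) * cut_below b G s)%:E)%E.
Proof.
move=> mG; rewrite -integral_itv_bndo_bndc; last first.
  apply/measurable_EFinP; apply: measurable_funM; apply: measurable_funTS => //.
  exact: measurable_kernel.
rewrite integral_mkcond; apply: eq_integral => s _.
rewrite /cut_below !patchE !mem_setE !in_itv/= andbT /tpow subr_gt0.
by case: leP => //= _; case: ltP => //= _; rewrite ?mulr0 ?mul0r.
Qed.

Lemma integral_kernel (p b t : R) : 0 < p -> b <= t ->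
  (\int[mu]_(s in `[b, t]) ((t - s) `^ (p - 1))%:E = ((t - b) `^ p / p)%:E)%E.
Proof.
move=> p0 bt; rewrite -integral_tpow ?subr_ge0//.
transitivity (\int[mu]_(s in `[b, t]) ((t - s) `^ (p - 1) * cst 1 s)%:E)%E.
  by apply: eq_integral => s _; rewrite /= mulr1.
rewrite integral_kernel_mkcond//.
rewrite (ge0_integral_reflect t); last 2 first.
- apply/measurable_EFinP/measurable_funM; first exact: measurable_tpowB.
  by apply: measurable_cut_below.
- by move=> s; rewrite lee_fin mulr_ge0 ?tpow_ge0// /cut_below patchE; case: ifP.
rewrite [RHS]integral_mkcond; apply: eq_integral => s _.
rewrite /cut_below !patchE !mem_setE !in_itv/= andbT opprB addrCA subrr addr0.
by rewrite lerBrDl -lerBrDr; case: ifP; rewrite ?mulr1 ?mulr0.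
Qed.

Lemma integrable_kernel (p b t : R) : 0 < p ->
  mu.-integrable `[b, t] (EFin \o (fun s : R => (t - s) `^ (p - 1))).
Proof.
move=> p0; have [tb|bt] := ltP t b.
  rewrite set_itv_ge ?bnd_simp -?ltNge//; exact: integrable_set0.
apply/integrableP; split.
  by apply/measurable_EFinP; apply: measurable_funTS; exact: measurable_kernel.
under eq_integral do rewrite /= ger0_norm ?powR_ge0//.
by rewrite integral_kernel// ltry.
Qed.

Lemma integrable_rlint (p b t M : R) (G : R -> R) : 0 < p ->
  measurable_fun `[b, t] G ->
  (forall s, b <= s <= t -> `|G s| <= M) ->
  mu.-integrable `[b, t] (EFin \o (fun s : R => (t - s) `^ (p - 1) * G s)).
Proof.
move=> p0 mG GM.
have iM : mu.-integrable `[b, t] (EFin \o (fun s => M * (t - s) `^ (p - 1))).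
  by exact: (integrableZl _ _ (integrable_kernel b t p0)).
apply: le_integrable iM => //=.
- apply/measurable_EFinP; apply: measurable_funM => //; apply: measurable_funTS.
  exact: measurable_kernel.
- move=> s /=; rewrite in_itv/= => /GM sM; rewrite lee_fin !normrM mulrC.
  by rewrite ler_wpM2r// (le_trans sM)// ler_norm.
Qed.

Lemma rlint_bound (p b t M : R) (G : R -> R) : 0 < p -> b <= t ->
  measurable_fun `[b, t] G ->
  (forall s, b <= s <= t -> `|G s| <= M) ->
  `|rlint p b G t| <= M * ((t - b) `^ p / p).
Proof.
move=> p0 bt mG GM; apply: le_trans (le_normr_Rintegral _ _) _ => //.
  exact: (integrable_rlint _ _ GM).
have -> : (t - b) `^ p / p = \int[mu]_(s in `[b, t]) (t - s) `^ (p - 1).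
  by rewrite /Rintegral integral_kernel.
rewrite -RintegralZl//; last exact: integrable_kernel.
apply: le_Rintegral => //.
- apply: integrable_norm; exact: (integrable_rlint _ _ GM).
- by exact: (integrableZl _ _ (integrable_kernel b t p0)).
- move=> s /=; rewrite in_itv/= => /GM sM.
  by rewrite normrM mulrC [`|_ `^ _|]ger0_norm ?powR_ge0// ler_wpM2r// powR_ge0.
Qed.

Lemma continuous_bounded (G : R -> R) b t : continuous G ->
  exists2 M, 0 <= M & forall s, b <= s <= t -> `|G s| <= M.
Proof.
move=> cG; have [bt|tb] := leP b t; last first.
  by exists 0 => // s /andP[bs st]; have := lt_le_trans tb (le_trans bs st); rewrite ltxx.
have [|c cbt H] := @EVT_max R (fun s => `|G s|) b t bt.
  by apply: continuous_subspaceT => s; apply: cvg_norm; exact: cG.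
by exists `|G c| => // s sbt; apply: H; rewrite in_itv.
Qed.

Lemma integrable_rlint_cont (p b t : R) (G : R -> R) : 0 < p -> continuous G ->
  mu.-integrable `[b, t] (EFin \o (fun s : R => (t - s) `^ (p - 1) * G s)).
Proof.
move=> p0 cG; have [M _ GM] := continuous_bounded b t cG.
apply: (integrable_rlint p0 _ GM); apply: measurable_funTS.
exact: continuous_measurable_fun.
Qed.

Lemma rlintB (p b t : R) (F G : R -> R) : 0 < p -> continuous F -> continuous G ->
  rlint p b (fun s => F s - G s) t = rlint p b F t - rlint p b G t.
Proof.
move=> p0 cF cG; rewrite /rlint -RintegralB//; last 2 first.
- exact: integrable_rlint_cont.
- exact: integrable_rlint_cont.
by apply: eq_Rintegral => s _; rewrite mulrBr.
Qed.

Lemma rlintZ (p b t c : R) (G : R -> R) : 0 < p -> continuous G ->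
  rlint p b (fun s => c * G s) t = c * rlint p b G t.
Proof.
move=> p0 cG; rewrite /rlint -RintegralZl//; last exact: integrable_rlint_cont.
by apply: eq_Rintegral => s _; rewrite mulrCA.
Qed.

Lemma eq_rlint (p b t : R) (F G : R -> R) : (forall s, b <= s <= t -> F s = G s) ->
  rlint p b F t = rlint p b G t.
Proof.
move=> FG; apply: eq_Rintegral => s; rewrite inE/= in_itv/= => /FG ->//.
Qed.

Lemma rlint0 (p b t : R) (G : R -> R) : t <= b -> rlint p b G t = 0.
Proof.
rewrite le_eqVlt => /predU1P[->|tb]; first by rewrite /rlint set_itv1 Rintegral_set1.
by rewrite /rlint set_itv_ge ?Rintegral_set0// bnd_simp -ltNge.
Qed.

Lemma continuous_pospow (p : R) : 0 < p ->
  continuous (fun x : R => (Num.max x 0) `^ p).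
Proof.
move=> p0 x; have [x0|x0|->] := ltgtP x 0.
- apply: (@near_cst_continuous _ _ (0 : R)).
  near=> z; rewrite max_r ?powR0 ?gt_eqF//; apply: ltW; near: z; exact: lt_nbhsl.
- have : {for x, continuous (fun x : R => x `^ p)}.
    apply/differentiable_continuous/derivable1_diffP.
    by apply: derivable_powR; rewrite in_itv/= x0.
  rewrite /prop_for /continuous_at max_l ?(ltW x0)// => ct; apply: cvg_trans ct.
  apply: near_eq_cvg; near=> z; rewrite max_l//.
  by apply: ltW; near: z; exact: lt_nbhsr.
- rewrite /continuous_at maxxx powR0 ?gt_eqF//.
  apply/cvgrPdist_lt => e e0; near=> z.
  rewrite sub0r normrN ger0_norm ?powR_ge0//.
  have -> : e = (e `^ p^-1) `^ p by rewrite -powRrM mulVf ?gt_eqF// powRr1// ltW.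
  rewrite gt0_ltr_powR// ?nnegrE ?powR_ge0// ?le_max ?lexx ?orbT//.
  rewrite gt_max powR_gt0// andbT (le_lt_trans (ler_norm _))//.
  near: z; apply/nbhs_ballP; exists (e `^ p^-1) => /=; first exact: powR_gt0.
  by move=> z; rewrite /ball/= sub0r normrN.
Unshelve. all: by end_near. Qed.

Lemma rlint_cst1 (p b t : R) : 0 < p ->
  rlint p b (cst 1) t = (Num.max (t - b) 0) `^ p / p.
Proof.
move=> p0; have [tb|bt] := leP t b.
  by rewrite rlint0// max_r ?subr_le0// powR0 ?mul0r// gt_eqF.
rewrite max_l ?subr_ge0 ?(ltW bt)// /rlint.
under eq_Rintegral do rewrite mulr1.
by rewrite /Rintegral integral_kernel// ltW.
Qed.

End RiemannLiouville.

(** * Continuity of the Riemann-Liouville integral *)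

Section Continuity.
Context {R : realType}.
Local Notation mu := (@lebesgue_measure R).

(** The substitution x = t - s moves t out of the bounds and out of the kernel;
G vanishes to the left of b, so every upper bound H >= t - b may be used, and
the same H serves all t near a given point. *)
Lemma rlint_reflect (p b t H : R) (G : R -> R) : continuous G ->
  (forall s, s <= b -> G s = 0) -> t - b <= H ->
  rlint p b G t = \int[mu]_(x in `]0, H]) (x `^ (p - 1) * G (t - x)).
Proof.
move=> cG Gb tH; congr fine.
have mG : measurable_fun setT G by exact: continuous_measurable_fun.
rewrite integral_kernel_mkcond// (integral_reflect t); last first.
  apply/measurable_EFinP/measurable_funM; first exact: measurable_tpowB.
  exact: measurable_cut_below.
rewrite [RHS]integral_mkcond; apply: eq_integral => x _.
rewrite /cut_below !patchE !mem_setE !in_itv/= andbT opprB addrCA subrr addr0 /tpow.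
case: (ltP 0 x) => [x0|]/=; last by rewrite mul0r.
case: leP => bx; case: leP => xH //.
- by rewrite [G _]Gb ?mulr0//; lra.
- by rewrite [G _]Gb ?mulr0// ltW.
- by rewrite mulr0.
Qed.

(** Subtracting the constant G(b) leaves a function that vanishes at b and
extends continuously by 0 to the left; after [rlint_reflect] its integral
depends on t only through this function, and dominated convergence applies.
The constant contributes an explicit multiple of (t - b)_+^p. *)
Lemma continuous_rlint (p b : R) (G : R -> R) : 0 < p -> continuous G ->
  continuous (rlint p b G).
Proof.
move=> p0 cG.
(* The function G - G b on [b, +oo), extended by 0. *)
pose G0 s := G (Num.max s b) - G b.
have cG0 : continuous G0.
  move=> s; apply: cvgB; last exact: cvg_cst.
  apply: (@continuous_comp _ _ _ (fun s => Num.max s b) G); last exact: cG.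
  by apply: continuous_max; [exact: cvg_id|exact: cvg_cst].
have G0b s : s <= b -> G0 s = 0.
  by move=> sb; rewrite /G0 max_r// subrr.
have E : rlint p b G = (fun t =>
    G b * ((Num.max (t - b) 0) `^ p / p) + rlint p b G0 t).
  apply/funext => t.
  have -> : rlint p b G0 t = rlint p b G t - G b * rlint p b (cst 1) t.
    rewrite -rlintZ//; last by move=> x; exact: cvg_cst.
    rewrite -rlintB//; last by move=> x; apply: cvgMr; exact: cvg_cst.
    by apply: eq_rlint => s /andP[bs _]; rewrite /G0 max_l// mulr1.
  by rewrite rlint_cst1//; ring.
rewrite E => t0; apply: cvgD.
  apply: cvgMr; apply: cvgMl.
  apply: (@continuous_comp _ _ _ (fun t => t - b) (fun x => Num.max x 0 `^ p)).
    by apply: cvgB; [exact: cvg_id|exact: cvg_cst].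
  exact: continuous_pospow.
pose H := Num.max (t0 + 1 - b) 0.
have H0 : 0 <= H by rewrite le_max lexx orbT.
pose F x := \int[mu]_(s in `]0, H]) (s `^ (p - 1) * G0 (x - s)).
have EF t : t <= t0 + 1 -> rlint p b G0 t = F t.
  move=> tt; apply: rlint_reflect => //.
  by rewrite le_max lerD2r tt.
suff cF : {for t0, continuous F}.
  rewrite /continuous_at EF ?lerDl//; apply: cvg_trans cF.
  apply: near_eq_cvg; near=> t; rewrite EF//.
  by apply: ltW; near: t; apply: lt_nbhsl; rewrite ltrDl.
have [M M0 GM] := continuous_bounded (t0 - 1 - H) (t0 + 1) cG0.
have ik : mu.-integrable `]0, H] (EFin \o (fun s : R => s `^ (p - 1))).
  apply/integrableP; split.
    by apply/measurable_EFinP; apply: measurable_funTS; exact: measurable_powR.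
  under eq_integral do rewrite /= ger0_norm ?powR_ge0//.
  by rewrite integral_powR// ltry.
have iM : mu.-integrable `]0, H] (EFin \o (fun s : R => M * s `^ (p - 1))).
  exact: (integrableZl _ _ ik).
have bd x s : `]t0 - 1, t0 + 1[%classic x -> `]0, H]%classic s ->
    `|s `^ (p - 1) * G0 (x - s)| <= M * s `^ (p - 1).
  rewrite /= !in_itv/= => /andP[x1 x2] /andP[s0 sH].
  rewrite normrM mulrC [`|_ `^ _|]ger0_norm ?powR_ge0// ler_wpM2r ?powR_ge0//.
  by apply: GM; apply/andP; split; lra.
apply: (@continuity_under_integral _ _ _ mu (fun x s => s `^ (p - 1) * G0 (x - s))
  `]0, H]%classic (measurable_itv _) (t0 - 1) (t0 + 1) _ _
  (fun s => M * s `^ (p - 1))).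
- move=> x xI; apply: (le_integrable _ _ _ iM) => //=.
    apply/measurable_EFinP; apply: measurable_funM; apply: measurable_funTS.
      exact: measurable_powR.
    apply: measurableT_comp; first exact: continuous_measurable_fun.
    exact: measurable_funB.
  move=> s sH; rewrite lee_fin (le_trans (bd _ _ xI sH))// ler_norm//.
- apply: aeW => s sH x _; apply: cvgMr.
  apply: (@continuous_comp _ _ _ (fun x => x - s) G0); last exact: cG0.
  by apply: cvgB; [exact: cvg_id|exact: cvg_cst].
- exact: iM.
- by move=> x xI; apply: aeW => s sH; exact: bd.
- by rewrite inE/= in_itv/=; apply/andP; split; lra.
Unshelve. all: by end_near. Qed.

End Continuity.

(** * The semigroup law *)

Section Semigroup.
Context {R : realType}.
Local Notation mu := (@lebesgue_measure R).

(** Euler's beta integral, in the extended reals: Tonelli's theorem applies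
before its finiteness is known, and then yields this finiteness. *)
Definition eBeta (p q : R) : \bar R :=
  (\int[mu]_x (tpow p (1 - x) * tpow q x)%:E)%E.

(** Both sides vanish for t <= s; otherwise substitute r = s + (t - s) x. *)
Lemma tpow_convolution (p q t s : R) :
  (\int[mu]_r (tpow p (t - r) * tpow q (r - s))%:E =
   eBeta p q * (tpow (p + q) (t - s))%:E)%E.
Proof.
have [ts|st] := leP t s.
  have -> : tpow (p + q) (t - s) = 0 by rewrite /tpow subr_gt0 ltNge ts.
  rewrite mule0 integral0_eq// => r _.
  rewrite /tpow !subr_gt0; case: ltP => rt; rewrite ?mul0r//.
case: ltP => sr; rewrite ?mulr0//.
  by have := lt_trans (lt_le_trans rt ts) sr; rewrite ltxx.
have c0 : 0 < t - s by rewrite subr_gt0.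
have mf : measurable_fun setT (fun r : R => (tpow p (t - r) * tpow q (r - s))%:E).
  apply/measurable_EFinP/measurable_funM; first exact: measurable_tpowB.
  by apply: measurableT_comp; [exact: measurable_tpow|exact: measurable_funB].
rewrite (ge0_integral_affine s c0)//; last first.
  by move=> r; rewrite lee_fin mulr_ge0 ?tpow_ge0.
set c := t - s.
have cE (x : R) : t - (c * x + s) = c * (1 - x) by rewrite /c; ring.
have -> : (\int[mu]_x (tpow p (t - (c * x + s)) * tpow q (c * x + s - s))%:E =
    (c `^ (p - 1) * c `^ (q - 1))%:E * eBeta p q)%E.
  rewrite -ge0_integralZl//=; last 3 first.
  - apply/measurable_EFinP/measurable_funM; last exact: measurable_tpow.
    exact: measurable_tpowB.
  - by move=> x _; rewrite lee_fin mulr_ge0 ?tpow_ge0.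
  - by rewrite lee_fin mulr_ge0 ?powR_ge0.
  apply: eq_integral => x _; rewrite addrK -EFinM; congr EFin.
  by rewrite cE !tpowM// mulrACA.
rewrite muleA muleC -EFinM; congr (_ * _%:E)%E.
have cN : c != 0 by rewrite gt_eqF.
rewrite /tpow c0 -powRD; last by rewrite cN implybT.
rewrite -[X in X * _](@powRr1 _ c (ltW c0)) -powRD; last by rewrite cN implybT.
by congr powR; ring.
Qed.


Lemma eBeta_gt0 (p q : R) : (0 < eBeta p q)%E.
Proof.
have mf : measurable_fun setT (fun x : R => (tpow p (1 - x) * tpow q x)%:E).
  apply/measurable_EFinP/measurable_funM; last exact: measurable_tpow.
  exact: measurable_tpowB.
have f0 (x : R) : (0 <= (tpow p (1 - x) * tpow q x)%:E)%E.
  by rewrite lee_fin mulr_ge0 ?tpow_ge0.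
apply: (@lt_le_trans _ _
    (\int[mu]_(x in `]0%R, 1%R[) (tpow p (1 - x) * tpow q x)%:E)%E).
  apply: integral_gt0 => //; first exact: measurable_funTS.
    move=> x /=; rewrite in_itv/= => /andP[x0 x1].
    by rewrite lte_fin /tpow subr_gt0 x0 x1 mulr_gt0// powR_gt0// subr_gt0.
  by rewrite lebesgue_measure_itv/= lte_fin ltr01 -EFinB subr0 lte_fin.
exact: ge0_subset_integral.
Qed.

(** The semigroup law for nonnegative G: exchange the integrals and apply
[tpow_convolution] to the inner one. *)
Lemma tpow_conv_tonelli (p q t : R) (G : R -> R) :
  measurable_fun setT G -> (forall s, 0 <= G s) ->
  (\int[mu]_r ((tpow p (t - r))%:E * \int[mu]_s (tpow q (r - s) * G s)%:E) =
   eBeta p q * \int[mu]_s (tpow (p + q) (t - s) * G s)%:E)%E.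
Proof.
move=> mG G0.
pose f (z : R * R) : \bar R :=
  (tpow p (t - z.1) * (tpow q (z.1 - z.2) * G z.2))%:E.
have mf : measurable_fun setT f.
  apply/measurable_EFinP; apply: measurable_funM.
    apply: (measurableT_comp (measurable_tpowB p t)); exact: measurable_fst.
  apply: measurable_funM.
    apply: (measurableT_comp (measurable_tpow q)).
    by apply: measurable_funB.
  by apply: measurableT_comp.
have f0 z : (0 <= f z)%E by rewrite lee_fin !mulr_ge0 ?tpow_ge0.
transitivity (\int[mu]_r \int[mu]_s f (r, s))%E.
  apply: eq_integral => r _; rewrite -ge0_integralZl//.
  - apply/measurable_EFinP/measurable_funM => //; exact: measurable_tpowB.
  - by move=> s _; rewrite lee_fin mulr_ge0 ?tpow_ge0.
  - by rewrite lee_fin tpow_ge0.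
rewrite fubini_tonelli// -ge0_integralZl//; last 3 first.
- apply/measurable_EFinP/measurable_funM => //; exact: measurable_tpowB.
- by move=> s _; rewrite lee_fin mulr_ge0 ?tpow_ge0.
- exact/ltW/eBeta_gt0.
apply: eq_integral => s _; rewrite /f/=.
transitivity (\int[mu]_r ((G s)%:E * (tpow p (t - r) * tpow q (r - s))%:E))%E.
  by apply: eq_integral => r _; rewrite -EFinM mulrA mulrC.
rewrite ge0_integralZl//.
- by rewrite tpow_convolution EFinM muleCA (muleC (G s)%:E).
- apply/measurable_EFinP/measurable_funM; first exact: measurable_tpowB.
  by apply: (measurableT_comp (measurable_tpow q)); exact: measurable_funB.
- by move=> r _; rewrite lee_fin mulr_ge0 ?tpow_ge0.
- by rewrite lee_fin.
Qed.

Lemma EFin_rlint (p b t : R) (G : R -> R) : 0 < p -> continuous G ->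
  ((rlint p b G t)%:E = \int[mu]_s (tpow p (t - s) * cut_below b G s)%:E)%E.
Proof.
move=> p0 cG; rewrite -integral_kernel_mkcond; last exact: continuous_measurable_fun.
by rewrite /rlint fineK// integrable_fin_num//; exact: integrable_rlint_cont.
Qed.

Let rlint_semigroup_ge0 (p q b t : R) (G : R -> R) : 0 < p -> 0 < q ->
  continuous G -> (forall s, 0 <= G s) ->
  ((rlint p b (rlint q b G) t)%:E = eBeta p q * (rlint (p + q) b G t)%:E)%E.
Proof.
move=> p0 q0 cG G0.
have mG : measurable_fun setT G by exact: continuous_measurable_fun.
rewrite EFin_rlint//; last exact: continuous_rlint.
rewrite EFin_rlint//; last exact: addr_gt0.
rewrite -tpow_conv_tonelli; last 2 first.
- exact: measurable_cut_below.
- by move=> s; rewrite /cut_below patchE; case: ifP.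
apply: eq_integral => r _; rewrite -EFin_rlint// -EFinM; congr (_ * _)%:E.
rewrite /cut_below patchE mem_setE in_itv/= andbT; case: leP => // rb.
by rewrite rlint0// ltW.
Qed.

(** In the semigroup law for the constant function 1 at b = 0, t = 1, the left
side is finite, and the factor of eBeta p q is positive. *)
Lemma eBeta_fin_num (p q : R) : 0 < p -> 0 < q -> eBeta p q \is a fin_num.
Proof.
move=> p0 q0; have := @rlint_semigroup_ge0 p q 0 1 (cst 1) p0 q0 _ _.
rewrite ge0_fin_numE; last exact/ltW/eBeta_gt0.
move=> /(_ (@cst_continuous _ _ _))/(_ (fun=> ler01)).
rewrite [X in (_ * X)%E]/= rlint_cst1 ?addr_gt0//.
rewrite ltey; case: (eBeta p q) => //= .
rewrite gt0_mulye// lte_fin divr_gt0 ?addr_gt0// subr0 max_l// powR1.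
Qed.

Definition Beta (p q : R) : R := fine (eBeta p q).

Lemma Beta_gt0 (p q : R) : 0 < p -> 0 < q -> 0 < Beta p q.
Proof. by move=> p0 q0; rewrite fine_gt0// eBeta_gt0 ltey_eq eBeta_fin_num. Qed.

(** Split G into its positive and negative parts. *)
Lemma rlint_semigroup (p q b t : R) (G : R -> R) : 0 < p -> 0 < q ->
  continuous G ->
  rlint p b (rlint q b G) t = Beta p q * rlint (p + q) b G t.
Proof.
move=> p0 q0 cG.
have H (F : R -> R) : continuous F -> (forall s, 0 <= F s) ->
    rlint p b (rlint q b F) t = Beta p q * rlint (p + q) b F t.
  move=> cF F0; apply: EFin_inj; rewrite rlint_semigroup_ge0//.
  by rewrite EFinM (_ : (Beta p q)%:E = eBeta p q)//; exact/fineK/eBeta_fin_num.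
pose P s := Num.max (G s) 0; pose N s := Num.max (- G s) 0.
have cP : continuous P.
  by move=> s; apply: continuous_max; [exact: cG|exact: cvg_cst].
have cN : continuous N.
  move=> s; apply: (@continuous_max _ _ (fun s => - G s) (cst 0)).
    by apply: cvgN; exact: cG.
  exact: cvg_cst.
have GE : G = (fun s => P s - N s).
  apply/funext => s; rewrite /P /N; case: (leP (G s) 0) => s0.
    by rewrite max_l ?oppr_ge0// sub0r opprK.
  by rewrite max_r ?subr0// oppr_le0 ltW.
have E r u : 0 < r -> rlint r b G u = rlint r b P u - rlint r b N u.
  by move=> r0; rewrite {1}GE rlintB.
rewrite (E (p + q)) ?addr_gt0// mulrBr -!H//; last 2 first.
- by move=> s; rewrite le_max lexx orbT.
- by move=> s; rewrite le_max lexx orbT.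
rewrite -rlintB//; [|exact: continuous_rlint..].
by apply: eq_rlint => s _; exact: E.
Qed.

End Semigroup.

(** * Positivity of the Gamma function *)

Section GammaPos.
Context {R : realType}.
Local Notation mu := (@lebesgue_measure R).

(** Convergence of Euler's integral is part of the claim, since a divergent
integral would make Gamma equal to 0: compare with s^(x-1) on (0, 1] and with
exp(-s) on (1, +oo), the latter because x <= 1. *)
Lemma Gamma_gt0 (x : R) : 0 < x -> x <= 1 -> 0 < Gamma x.
Proof.
move=> x0 x1.
have m1 : measurable_fun setT (fun s : R => s `^ (x - 1) * expR (- s)).
  apply: measurable_funM; first exact: measurable_powR.
  by apply: measurableT_comp.
have ix : mu.-integrable `]0, +oo[ (EFin \o
    (fun s : R => s `^ (x - 1) * expR (- s))).
  have -> : `]0, +oo[%classic = `]0, 1] `|` `]1, +oo[ :> set R.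
    by apply: itv_bndbnd_setU; rewrite bnd_simp.
  apply/integrableP; split.
    by apply/measurable_EFinP; exact: measurable_funTS.
  rewrite ge0_integral_setU//=; last 2 first.
  - do 2 apply: measurableT_comp => //; exact: measurable_funTS.
  - rewrite disj_set2E; apply/eqP/seteqP; split=> s //= [].
    by rewrite !in_itv/= andbT => /andP[_]; rewrite leNgt => /negP.
  rewrite lte_add_pinfty//.
    apply: (@le_lt_trans _ _ (\int[mu]_(s in `]0%R, 1%R]) (s `^ (x - 1))%:E)%E).
      apply: ge0_le_integral => //=.
      - do 2 apply: measurableT_comp => //; exact: measurable_funTS.
      - by apply/measurable_EFinP; apply: measurable_funTS; exact: measurable_powR.
      - move=> s; rewrite in_itv/= => /andP[s0 _].
        rewrite lee_fin ger0_norm ?mulr_ge0 ?powR_ge0 ?expR_ge0//.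
        by rewrite ler_piMr ?powR_ge0// -expR0 ler_expR oppr_le0 ltW.
    by rewrite integral_powR// ltry.
  have /integrableP[_] := @integrable_exponential_pdf R 1 ltr01.
  apply: le_lt_trans; rewrite [leLHS]integral_mkcond; apply: ge0_le_integral => //=.
  - by move=> s _; rewrite patchE; case: ifP.
  - apply/(measurable_restrictT (fun s : R => `|(s `^ (x - 1) * expR (- s))%:E|%E)) => //.
    do 2 apply: measurableT_comp => //; exact: measurable_funTS.
  - by do 2 apply: measurableT_comp => //; exact: measurable_exponential_pdf.
  - move=> s _; rewrite patchE mem_setE in_itv/= andbT.
    case: ltP => s1; last by rewrite lee_fin.
    rewrite lee_fin exponential_pdfE; last by rewrite ltW// (lt_trans ltr01).
    rewrite mul1r mulN1r.
    rewrite !ger0_norm ?mulr_ge0 ?powR_ge0 ?expR_ge0//.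
    rewrite ler_piMl ?expR_ge0// -[leRHS](powRr0 s) ler_powR//; first exact: ltW.
    by rewrite subr_le0.
apply: fine_gt0; rewrite -ge0_fin_numE ?integrable_fin_num ?andbT//; last first.
  by apply: integral_ge0 => s _; rewrite lee_fin mulr_ge0 ?powR_ge0 ?expR_ge0.
apply: integral_gt0 => //.
- by apply/measurable_EFinP; exact: measurable_funTS.
- move=> s /=; rewrite in_itv/= andbT => s0.
  by rewrite lte_fin mulr_gt0 ?powR_gt0 ?expR_gt0.
- by rewrite lebesgue_measure_itv/= ?ltry.
Qed.

End GammaPos.

(** * One-sided derivatives *)

Section DeriveWithin.
Context {R : realType}.
Implicit Types (g : R -> R) (b T x : R).

Lemma derivable_within_cvg (A : set R) g x : derivable_within A g x ->
  g z @[z --> within A (nbhs x)] --> g x.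
Proof.
set q := fun z => (g z - g x) / (z - x).
move=> /cvg_ex[l ql].
have h : (g x + q z * (z - x)) @[z --> within A x^'] --> g x + l * (x - x).
  apply: cvgD; first exact: cvg_cst.
  apply: cvgM => //; apply: cvgB; last exact: cvg_cst.
  apply: cvg_within_filter; exact: nbhs_dnbhs.
rewrite subrr mulr0 addr0 in h.
apply/cvgrPdist_lt => e e0.
move/cvgrPdist_lt : h => /(_ e e0) /=.
rewrite !near_withinE; apply: filterS => z H Az.
have [->|zx] := eqVneq z x; first by rewrite subrr normr0.
have := H zx Az; rewrite /q divfK ?subr_eq0//.
by rewrite [X in _ - X]addrCA subrr addr0.
Qed.

(** Near an interior point the set [b, T] imposes no restriction. *)
Lemma derive_within_interior b T g x : b < x < T ->
  derivable_within `[b, T] g x -> is_derive x 1 g (derive_within `[b, T] g x).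
Proof.
move=> /andP[bx xT] dg; set l := derive_within _ _ _.
have H : h^-1 *: ((g \o shift x) (h *: 1) - g x) @[h --> 0^'] --> l.
  apply/cvgrPdist_lt => e e0.
  move/cvgrPdist_lt : dg => /(_ e e0); rewrite !near_withinE.
  have : \forall z \near x, z \in `]b, T[ by apply: near_in_itvoo; rewrite in_itv/= bx.
  move=> /filterI/[apply] /nbhs_ballP[d /= d0 dH].
  apply/nbhs_ballP; exists d => //= h; rewrite /ball/= sub0r normrN => hd h0.
  have [|zI Hz] := dH (h + x).
    by rewrite /ball/= opprD addrCA subrr addr0 normrN.
  have := Hz _ _; rewrite addrK => Hz'.
  rewrite /GRing.scale/= mulr1 mulrC; apply: Hz'.
    by rewrite -subr_eq0 addrK.
  by move: zI; rewrite !in_itv/= => /andP[/ltW-> /ltW->].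
by apply: DeriveDef; [apply/cvg_ex; exists l|exact: cvg_lim].
Qed.

Lemma derivable_within_sub_cont (A B : set R) g : B `<=` A ->
  (forall x, B x -> derivable_within A g x) -> {within B, continuous g}.
Proof.
move=> BA dg; apply/subspace_continuousP => x Bx.
move=> P /(derivable_within_cvg (dg x Bx)) AP.
have {}AP : \forall z \near x, A z -> P (g z) := AP.
change (\forall z \near x, B z -> P (g z)).
apply: filterS AP => z Hz Bz; exact: Hz (BA _ Bz).
Qed.

End DeriveWithin.

(** * Functions with a prescribed derivative of higher order *)

Section Repr.
Context {R : realType}.
Local Notation mu := (@lebesgue_measure R).

Lemma is_derive_rlint1 (b t : R) (G : R -> R) : continuous G -> b < t ->
  is_derive t 1 (rlint 1 b G) (G t).
Proof.
move=> cG bt.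
have -> : rlint 1 b G = fun x => \int[mu]_(s in `[b, x]) G s.
  apply/funext => x; apply: eq_Rintegral => s _.
  by rewrite subrr powRr0 mul1r.
have tt : t < t + 1 by rewrite ltrDl.
have iG : mu.-integrable `[b, t + 1] (EFin \o G).
  apply: continuous_compact_integrable; first exact: segment_compact.
  exact: continuous_subspaceT.
have [d1 d2] := continuous_FTC1_closed tt iG bt (cG t).
by apply: DeriveDef; [exact: d1|rewrite -derive1E d2].
Qed.

Lemma poly_primitive (P : {poly R}) :
  exists2 Q : {poly R}, Q^`() = P & (size Q <= (size P).+1)%N.
Proof.
exists (\poly_(i < (size P).+1) (P`_i.-1 / i%:R)); last exact: size_poly.
apply/polyP => i; rewrite coef_deriv coef_poly ltnS /=.
case: leqP => iP; first by rewrite mul0rn nth_default.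
by rewrite -(mulr_natr (_ / _)) divfK// pnatr_eq0.
Qed.

Lemma derive0_eq (h : R -> R) (c d : R) : c <= d ->
  {within `[c, d], continuous h} -> (forall z, c < z < d -> is_derive z 1 h 0) ->
  h c = h d.
Proof.
move=> cd ch dh.
have dh' (x : R) : x \in `]c, d[ -> is_derive x 1 h 0 by rewrite in_itv/= => /dh.
have [x _] := MVT_segment (df := fun=> 0) cd dh' ch.
by rewrite mul0r => /eqP; rewrite subr_eq0 => /eqP.
Qed.

Lemma is_derive_horner_shift (P : {poly R}) (b z : R) :
  is_derive z 1 (fun t => P.[t - b]) P^`().[z - b].
Proof.
rewrite -[X in is_derive _ _ _ X]mulr1.
apply: (@is_derive1_comp R (horner P) (fun t => t - b)).
by apply: is_derive_eq; rewrite subr0.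
Qed.

Lemma continuous_horner_shift (P : {poly R}) (b : R) :
  continuous (fun t => P.[t - b]).
Proof.
move=> x; apply/differentiable_continuous/derivable1_diffP.
by have [] := is_derive_horner_shift P b x.
Qed.

Lemma continuous_iter_rlint1 m b (F : R -> R) : continuous F ->
  continuous (iter m (rlint 1 b) F).
Proof. by move=> cF; elim: m => //= m IH; apply: continuous_rlint. Qed.

(** Integrate the equation m times.  Each step produces a function with zero
derivative on (b, T), hence one more constant of integration; these constants
form the polynomial P.  Nothing is known at b, which is why w and its iterated
integral are compared on (b, T] only. *)
Lemma antiderivative_repr (m : nat) (b T : R) (w F : R -> R) : b < T ->
  continuous F ->
  (forall k t, (k < m)%N -> t \in `]b, T] ->
     derivable_within `[b, T] (derive_within_n `[b, T] k w) t) ->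
  (forall t, t \in `]b, T] -> derive_within_n `[b, T] m w t = F t) ->
  exists2 P : {poly R}, (size P <= m)%N &
    forall t, t \in `]b, T] -> w t = iter m (rlint 1 b) F t + P.[t - b].
Proof.
move=> bT cF; elim: m w => [|m IH] w dw wF.
  by exists 0; rewrite ?size_poly0// => t tT; rewrite horner0 addr0 /= -wF.
have [|t tT|P sP PE] := IH (derive_within `[b, T] w).
- by move=> k t km tT; have := dw k.+1 t; rewrite /derive_within_n iterSr; apply.
- by rewrite -wF// /derive_within_n iterSr.
have [Q QP sQ] := poly_primitive P.
set I := iter m (rlint 1 b) F in PE.
have cI : continuous I by exact: continuous_iter_rlint1.
pose h t := w t - (rlint 1 b I t + Q.[t - b]).
have bTT : T \in `]b, T] by rewrite in_itv/= bT lexx.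
have hc t : t \in `]b, T] -> h t = h T.
  rewrite in_itv/= => /andP[bt tT].
  apply: derive0_eq => //.
    apply: (@within_continuousB _ _ R^o).
      apply: (derivable_within_sub_cont (A := `[b, T])).
        by move=> x /=; rewrite !in_itv/= => /andP[tx ->]; rewrite (le_trans (ltW bt)).
      move=> x /=; rewrite in_itv/= => /andP[tx xT].
      by apply: (dw 0%N) => //; rewrite in_itv/= xT (lt_le_trans bt).
    apply: continuous_subspaceT => x; apply: cvgD; first exact: continuous_rlint.
    exact: continuous_horner_shift.
  move=> z /andP[tz zT].
  have bz : b < z by exact: lt_trans tz.
  have zI : z \in `]b, T] by rewrite in_itv/= bz ltW.
  have bzT : b < z < T by rewrite bz.
  have d1 := derive_within_interior bzT (dw 0%N _ isT zI).
  have d2 := is_derive_rlint1 cI bz.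
  have d3 := is_derive_horner_shift Q b z.
  rewrite QP in d3.
  have := is_deriveB d1 (is_deriveD d2 d3).
  by rewrite PE// subrr.
exists (Q + (h T)%:P).
  rewrite (leq_trans (size_polyD _ _))// geq_max (leq_trans sQ)//=.
  by rewrite size_polyC; case: eqP.
move=> t tT; rewrite -(hc t tT) hornerD hornerC /h -/I iterS; ring.
Qed.

End Repr.

(** * Flatness at the starting point *)

Section Flat.
Context {R : realType}.
Local Notation mu := (@lebesgue_measure R).

(** Cauchy's formula for repeated integration, by the semigroup law; c is
1/m!. *)
Lemma iter_rlint1E (m : nat) : exists2 c : R, 0 < c &
  forall b t (F : R -> R), continuous F ->
    iter m.+1 (rlint 1 b) F t = c * rlint m.+1%:R b F t.
Proof.
elim: m => [|m [c c0 IH]]; first by exists 1 => // b t F cF; rewrite mul1r.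
exists (c * Beta 1 m.+1%:R); first by rewrite mulr_gt0// Beta_gt0.
move=> b t F cF; rewrite iterS.
rewrite (@eq_rlint _ _ _ _ _ (fun s => c * rlint m.+1%:R b F s)); last first.
  by move=> s _; exact: IH.
rewrite rlintZ//; last exact: continuous_rlint.
have -> : m.+2%:R = 1 + m.+1%:R :> R by rewrite [LHS]mulrS.
by rewrite rlint_semigroup// mulrA.
Qed.

(** w(t) = o((t - b)^n) as t decreases to b. *)
Definition flat (n : nat) (b : R) (w : R -> R) : Prop :=
  forall e, 0 < e -> \forall t \near b^'+, `|w t| <= e * (t - b) ^+ n.

Lemma flatB n b w1 w2 : flat n b w1 -> flat n b w2 ->
  flat n b (fun t => w1 t - w2 t).
Proof.
move=> f1 f2 e e0; have e2 : 0 < e / 2 by rewrite divr_gt0.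
near=> t.
have h1 : `|w1 t| <= e / 2 * (t - b) ^+ n by near: t; exact: f1.
have h2 : `|w2 t| <= e / 2 * (t - b) ^+ n by near: t; exact: f2.
rewrite (le_trans (ler_normB _ _))// (le_trans (lerD h1 h2))//.
by rewrite -mulrDl -splitr.
Unshelve. all: by end_near. Qed.

(** By continuity of P the bound passes to the limit t = b, where it is
arbitrarily small. *)
Lemma poly_flat_root (n : nat) (b : R) (P : {poly R}) :
  flat n b (fun t => P.[t - b]) -> P.[0] = 0.
Proof.
move=> fP; apply/eqP; rewrite -normr_eq0 eq_le normr_ge0 andbT.
apply/ler_addgt0Pr => e e0; rewrite add0r.
have e2 : 0 < e / 2 by rewrite divr_gt0.
have cP : {for b, continuous (fun t => P.[t - b])}.
  exact: continuous_horner_shift.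
have := cvg_at_right_filter cP; rewrite subrr => /cvgrPdist_le/(_ _ e2) nP.
near b^'+ => t.
have t0 : 0 <= t - b by rewrite subr_ge0; apply: ltW; near: t; exact: nbhs_right_gt.
have t1 : t - b <= 1.
  by rewrite lerBlDr addrC; apply: ltW; near: t; apply: nbhs_right_lt; rewrite ltrDl.
have H1 : `|P.[t - b]| <= e / 2.
  apply: (@le_trans _ _ (e / 2 * (t - b) ^+ n)); first by near: t; exact: fP.
  by rewrite ler_piMr ?exprn_ile1// ltW.
have H2 : `|P.[0] - P.[t - b]| <= e / 2 by near: t; exact: nP.
rewrite -(subrK P.[t - b] P.[0]).
by rewrite (le_trans (ler_normD _ _))// (le_trans (lerD H2 H1))// -splitr.
Unshelve. all: by end_near. Qed.

(** P is divisible by X because P(0) = 0, and the quotient is flat of order one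
less. *)
Lemma poly_flat_eq0 (n : nat) (b : R) (P : {poly R}) : (size P <= n.+1)%N ->
  flat n b (fun t => P.[t - b]) -> P = 0.
Proof.
elim: n P => [|n IH] P; elim/poly_ind: P => // P c _ sP fP.
  have := poly_flat_root fP; rewrite !hornerE => c0.
  move: sP; rewrite size_MXaddC c0 eqxx andbT polyC0 addr0.
  case: eqP => [->|_]; first by rewrite mul0r.
  by rewrite ltnS leqn0 size_poly_eq0 => /eqP->; rewrite mul0r.
have := poly_flat_root fP; rewrite !hornerE => c0.
move: sP fP; rewrite size_MXaddC c0 eqxx andbT polyC0 addr0.
case: eqP => [->|_ sP fP]; first by rewrite mul0r.
rewrite (IH P) ?mul0r// => e e0; near=> t.
have t0 : 0 < t - b by rewrite subr_gt0; near: t; exact: nbhs_right_gt.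
have : `|(P * 'X).[t - b]| <= e * (t - b) ^+ n.+1 by near: t; exact: fP.
by rewrite hornerMX normrM (gtr0_norm t0) exprSr mulrA ler_pM2r.
Unshelve. all: by end_near. Qed.

End Flat.

Section NearRight.
Context {R : realType}.

Lemma near_right_itv (b : R) (Q : R -> Prop) : (\forall t \near b^'+, Q t) ->
  exists2 d, 0 < d & forall t, b < t < b + d -> Q t.
Proof.
rewrite /at_right near_withinE => /nbhs_ballP[d /= d0 dH].
exists d => // t /andP[bt td]; apply: dH => //=.
by rewrite /ball/= distrC gtr0_norm ?subr_gt0// ltrBlDl.
Qed.

End NearRight.

(** * Flatness of the Taylor remainder *)

Section Taylor.
Context {R : realType} (b T : R).
Local Notation mu := (@lebesgue_measure R).
Local Notation D := (derive_within `[b, T]).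

Definition taylor_pol n (y : R -> R) : {poly R} :=
  \poly_(k < n.+1) (derive_within_n `[b, T] k y b / k`!%:R).

Lemma taylor_polyE n y t : taylor_poly b T n.+1 y t = (taylor_pol n y).[t - b].
Proof. by rewrite horner_poly. Qed.

Lemma deriv_taylor_pol n y : (taylor_pol n.+1 y)^`() = taylor_pol n (D y).
Proof.
apply/polyP => i; rewrite coef_deriv !coef_poly ltnS.
case: ifP => _; last by rewrite mul0rn.
rewrite /derive_within_n iterSr factS natrM -(mulr_natr (_ / _)).
field; rewrite !pnatr_eq0 -lt0n fact_gt0//=.
Qed.

Lemma Cn_on_derive n y : Cn_on `[b, T] n.+1 y -> Cn_on `[b, T] n (D y).
Proof.
move=> [dy cy]; split; last by move: cy; rewrite /derive_within_n iterSr.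
by move=> k x kn; have := dy k.+1 x kn; rewrite /derive_within_n iterSr.
Qed.

Lemma Cn_on_continuous n y : Cn_on `[b, T] n y -> {within `[b, T], continuous y}.
Proof.
case: n => [[_]//|n [dy _]].
by apply: (derivable_within_sub_cont (A := `[b, T])) => // x xT; exact: (dy 0%N).
Qed.

(** Peano's form of the Taylor remainder.  By the mean value theorem the
remainder of y of order n + 1 at t is (t - b) times the remainder of y' of
order n at some point of (b, t). *)
Lemma taylor_flat n y : b < T -> Cn_on `[b, T] n y ->
  flat n b (fun t => y t - (taylor_pol n y).[t - b]).
Proof.
move=> bT; elim: n y => [|n IH] y Cy e e0.
  have [_ /(continuous_within_itvP _ bT)[_ + _]] := Cy.
  move=> /cvgrPdist_le/(_ e e0); apply: filterS => t /=.
  rewrite /derive_within_n/= expr0 mulr1 distrC.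
  by rewrite horner_poly big_ord1 /= expr0 mulr1 fact0 divr1.
have [d d0 H] := near_right_itv (IH _ (Cn_on_derive Cy) e e0).
have Cyc := Cn_on_continuous Cy.
pose h t := y t - (taylor_pol n.+1 y).[t - b].
have hb : h b = 0.
  by rewrite /h subrr horner_coef0 coef_poly /= fact0 divr1 subrr.
near=> t.
have bt : b < t by near: t; exact: nbhs_right_gt.
have tT : t < T by near: t; exact: nbhs_right_lt.
have td : t < b + d by near: t; apply: nbhs_right_lt; rewrite ltrDl.
have dh (z : R) : z \in `]b, t[ ->
    is_derive z 1 h (D y z - (taylor_pol n (D y)).[z - b]).
  rewrite in_itv/= => /andP[bz zt].
  rewrite -deriv_taylor_pol; apply: is_deriveB; last exact: is_derive_horner_shift.
  apply: derive_within_interior; first by rewrite bz (lt_trans zt).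
  have [dy _] := Cy; apply: (dy 0%N) => //=.
  by rewrite in_itv/= (ltW bz) (ltW (lt_trans zt tT)).
have ch : {within `[b, t], continuous h}.
  apply: (@within_continuousB _ _ R^o).
    apply: continuous_subspaceW Cyc.
    by move=> x /=; rewrite !in_itv/= => /andP[-> xt]; rewrite (le_trans xt)// ltW.
  by apply: continuous_subspaceT; exact: continuous_horner_shift.
have [z] := MVT bt dh ch.
rewrite in_itv/= => /andP[bz zt].
rewrite hb subr0 => ht; rewrite -/(h t) ht normrM (gtr0_norm (x := t - b)) ?subr_gt0//.
rewrite exprSr mulrA ler_pM2r ?subr_gt0//.
apply: le_trans (H z _) _; first by rewrite bz (lt_trans zt).
rewrite ler_pM2l// lerXn2r ?nnegrE ?subr_ge0 ?(ltW bt) ?(ltW bz)//.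
by rewrite lerD2r ltW.
Unshelve. all: by end_near. Qed.


End Taylor.

(** * Extending functions from an interval *)

Section Clamp.
Context {R : realType}.

Lemma continuous_comp_within (T1 T2 : topologicalType) (A : set T1)
    (phi : R -> T1) (g : T1 -> T2) : continuous phi -> (forall x, A (phi x)) ->
  {within A, continuous g} -> continuous (g \o phi).
Proof.
move=> cphi Aphi /subspace_continuousP cg x P.
move=> /(cg _ (Aphi x)) AP.
have {}AP : \forall z \near phi x, A z -> P (g z) := AP.
change (\forall z \near x, P (g (phi z))).
have H : \forall z \near x, A (phi z) -> P (g (phi z)) := cphi x _ AP.
by apply: filterS H => z; apply; exact: Aphi.
Qed.

(** Composition with the projection onto [c, d] extends a function continuous
on [c, d] to a function continuous on the line. *)
Definition clamp (c d t : R) : R := Num.max c (Num.min t d).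

Lemma clamp_itv c d t : c <= d -> clamp c d t \in `[c, d].
Proof. by move=> cd; rewrite in_itv/= le_max lexx/= ge_max cd ge_min lexx orbT. Qed.

Lemma clamp_id c d t : c <= t <= d -> clamp c d t = t.
Proof. by move=> /andP[ct td]; rewrite /clamp min_l// max_r. Qed.

Lemma continuous_clamp c d : continuous (clamp c d).
Proof.
move=> t; apply: (@continuous_max _ _ (cst c) (fun t => Num.min t d)).
  exact: cvg_cst.
by apply: (@continuous_min _ _ id (cst d)); [exact: cvg_id|exact: cvg_cst].
Qed.

Lemma continuous_comp_clamp c d (g : R -> R) : c <= d ->
  {within `[c, d], continuous g} -> continuous (g \o clamp c d).
Proof.
move=> cd; apply: continuous_comp_within; first exact: continuous_clamp.
by move=> x; apply: clamp_itv.
Qed.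

End Clamp.

(** * Ingredients of the Volterra equation *)

Section Volterra.
Context {R : realType}.
Local Notation mu := (@lebesgue_measure R).

(** Differentiate the vanishing integral; the endpoint T follows by continuity. *)
Lemma rlint1_eq0 (b T : R) (G : R -> R) : b < T -> continuous G ->
  (forall t, b <= t <= T -> rlint 1 b G t = 0) ->
  forall t, b < t <= T -> G t = 0.
Proof.
move=> bT cG G0.
have G0' t : b < t < T -> G t = 0.
  move=> /andP[bt tT].
  have [_ <-] := is_derive_rlint1 cG bt.
  rewrite -(derive_cst (0 : R) t (1 : R)); apply: near_eq_derive.
  near=> s; rewrite G0//; apply/andP; split; apply: ltW; near: s.
    exact: lt_nbhsr.
  exact: lt_nbhsl.
move=> t /andP[bt]; rewrite le_eqVlt => /predU1P[->|tT]; last by apply: G0'; rewrite bt.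
have c1 : G x @[x --> T^'-] --> G T by apply: cvg_at_left_filter; exact: cG.
have c2 : G x @[x --> T^'-] --> (0 : R).
  have c3 : (fun=> 0 : R) x @[x --> T^'-] --> (0 : R) by exact: cvg_cst.
  apply: cvg_trans c3; apply: near_eq_cvg; near=> x.
  apply/esym/G0'; apply/andP; split; near: x.
    exact: nbhs_left_gt.
  exact: nbhs_left_lt.
exact: (cvg_unique _ c1 c2).
Unshelve. all: by end_near. Qed.

Lemma caputo_orderS (alpha : R) : 0 < alpha ->
  exists n, [/\ caputo_order alpha = n.+1, alpha <= n.+1%:R & n.+1%:R - alpha < 1].
Proof.
move=> a0.
have c0 : (0 < Num.ceil alpha) by rewrite ceil_gt0.
have cE : (Num.ceil alpha)%:~R = (caputo_order alpha)%:R :> R.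
  by rewrite /caputo_order -[in LHS](gtz0_abs c0).
exists (caputo_order alpha).-1.
have m0 : (0 < caputo_order alpha)%N by rewrite /caputo_order absz_gt0 gt_eqF.
rewrite prednK//; split => //; rewrite -cE.
  exact: ceil_ge.
have /andP[+ _] := ceil_itv alpha.
by rewrite intrB ltrBlDr addrC -ltrBlDr ltrBlDl addrC -ltrBlDl.
Qed.

Lemma flat_rlint (n : nat) (p b : R) (g : R -> R) : 0 < p -> continuous g ->
  g b = 0 -> flat n b g -> flat n b (rlint p b g).
Proof.
move=> p0 cg gb fg e e0.
have ep : 0 < e * p by rewrite mulr_gt0.
have [d d0 H] := near_right_itv (fg _ ep).
near=> t.
have bt : b < t by near: t; exact: nbhs_right_gt.
have td : t < b + d by near: t; apply: nbhs_right_lt; rewrite ltrDl.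
have tb1 : t - b <= 1.
  by rewrite lerBlDr addrC; apply: ltW; near: t; apply: nbhs_right_lt; rewrite ltrDl.
have tb0 : 0 <= t - b by rewrite subr_ge0 ltW.
have mg : measurable_fun `[b, t] g.
  by apply: measurable_funTS; exact: continuous_measurable_fun.
apply: (@le_trans _ _ (e * p * (t - b) ^+ n * ((t - b) `^ p / p))).
  apply: (rlint_bound p0 (ltW bt) mg).
  move=> s /andP[]; rewrite le_eqVlt => /predU1P[<- _|bs st].
    by rewrite gb normr0 !mulr_ge0 ?exprn_ge0// ltW.
  apply: le_trans (H _ _) _; first by rewrite bs (le_lt_trans st).
  by rewrite ler_pM2l// lerXn2r ?nnegrE ?subr_ge0 ?(ltW bs)// lerD2r.
rewrite (_ : _ * _ = e * (t - b) ^+ n * (t - b) `^ p); last first.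
  by field; rewrite gt_eqF.
rewrite ler_piMr//; first by rewrite mulr_ge0 ?exprn_ge0// ltW.
have -> : 1 = 1 `^ p :> R by rewrite powR1.
by rewrite ge0_ler_powR// ?nnegrE// ltW.
Unshelve. all: by end_near. Qed.

Lemma flatZ n b c (w : R -> R) : flat n b w -> flat n b (fun t => c * w t).
Proof.
move=> fw e e0; have c1 : 0 < `|c| + 1 by rewrite ltr_wpDl.
have ec : 0 < e / (`|c| + 1) by rewrite divr_gt0.
near=> t.
have t0 : 0 <= t - b by rewrite subr_ge0; apply: ltW; near: t; exact: nbhs_right_gt.
have h : `|w t| <= e / (`|c| + 1) * (t - b) ^+ n by near: t; exact: fw.
rewrite normrM; apply: (@le_trans _ _ ((`|c| + 1) * `|w t|)).
  by rewrite ler_wpM2r// lerDl.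
apply: le_trans (ler_wpM2l (ltW c1) h) _.
by rewrite mulrA mulrCA divff ?mulr1// gt_eqF.
Unshelve. all: by end_near. Qed.

(** F is bounded near b, so this integral is O((t - b)^(n+1)). *)
Lemma flat_rlint_cont (n : nat) (b : R) (F : R -> R) : continuous F ->
  flat n b (rlint n.+1%:R b F).
Proof.
move=> cF e e0.
have [M M0 FM] := continuous_bounded b (b + 1) cF.
have M1 : 0 < M + 1 by rewrite ltr_wpDl.
near=> t.
have bt : b < t by near: t; exact: nbhs_right_gt.
have tb1 : t <= b + 1.
  by apply: ltW; near: t; apply: nbhs_right_lt; rewrite ltrDl.
have tb0 : 0 <= t - b by rewrite subr_ge0 ltW.
have te : t - b <= e / (M + 1).
  rewrite lerBlDr addrC; apply: ltW; near: t; apply: nbhs_right_lt.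
  by rewrite ltrDl divr_gt0.
apply: (@le_trans _ _ ((M + 1) * ((t - b) `^ n.+1%:R / n.+1%:R))).
  apply: rlint_bound => //.
  - by apply: measurable_funTS; exact: continuous_measurable_fun.
  move=> s /andP[bs st]; apply: le_trans (FM s _) _; last by rewrite lerDl.
  by rewrite bs (le_trans st).
rewrite powR_mulrn// exprSr.
apply: (@le_trans _ _ ((M + 1) * ((t - b) ^+ n * (t - b)))).
  rewrite ler_pM2l// ler_pdivrMr ?ltr0n// ler_peMr ?mulr_ge0 ?exprn_ge0//.
  by rewrite ler1n.
rewrite mulrCA mulrC ler_wpM2r ?exprn_ge0//.
by rewrite mulrC -ler_pdivlMr.
Unshelve. all: by end_near. Qed.

End Volterra.

(** * The Volterra equation of a Caputo problem *)

Section CaputoVolterra.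
Context {R : realType}.
Local Notation mu := (@lebesgue_measure R).

(** The polynomial of [antiderivative_repr] is the difference of w and of the
iterated integral, both flat, and therefore vanishes. *)
Lemma flat_antiderivative (n : nat) (b T : R) (w F : R -> R) : b < T ->
  continuous F ->
  (forall k t, (k < n.+1)%N -> t \in `]b, T] ->
     derivable_within `[b, T] (derive_within_n `[b, T] k w) t) ->
  (forall t, t \in `]b, T] -> derive_within_n `[b, T] n.+1 w t = F t) ->
  flat n b w ->
  forall t, t \in `]b, T] -> w t = iter n.+1 (rlint 1 b) F t.
Proof.
move=> bT cF dw wF fw t tT.
have [P sP PE] := antiderivative_repr bT cF dw wF.
suff P0 : P = 0 by rewrite PE// P0 horner0 addr0.
apply: (poly_flat_eq0 sP (b := b)).
have [c _ cI] := iter_rlint1E (R := R) n.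
have fI : flat n b (iter n.+1 (rlint 1 b) F).
  move=> e e0; have := flatZ c (flat_rlint_cont n b cF) e0.
  by apply: filterS => s; rewrite cI.
move=> e e0; have nw := flatB fw fI e0; near=> s.
have sT : s \in `]b, T].
  rewrite in_itv/=; apply/andP; split; first by near: s; exact: nbhs_right_gt.
  by apply: ltW; near: s; exact: nbhs_right_lt.
have -> : P.[s - b] = w s - iter n.+1 (rlint 1 b) F s.
  by rewrite PE// [RHS]addrC addKr.
by near: s; exact: nw.
Unshelve. all: by end_near. Qed.

(** With g the Taylor remainder of y and c the constant of Cauchy's formula,
[flat_antiderivative] gives J^beta g = c rl(m) F.  This is the claim for integer
alpha, where beta = 0.  Otherwise rl(beta) g = Gamma(beta) c rl(m) F; applying rl(1 - beta)
gives B(1 - beta, beta) rl(1) g = Gamma(beta) c B(1 - beta, m) rl(1 + alpha) F,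
and rl(1 + alpha) F = rl(1) (rl(alpha) F) / B(1, alpha).  So g - kappa rl(alpha) F
has zero integral over every [b, t], for the kappa defined below. *)
Theorem caputo_volterra (alpha : R) : 0 < alpha -> exists2 kappa : R, 0 < kappa &
  forall (b T : R) (y F : R -> R), b < T -> continuous F ->
    Cn_on `[b, T] (caputo_order alpha).-1 y ->
    (forall t, t \in `]b, T] ->
      caputo_derivable alpha b T y t /\ caputo alpha b T y t = F t) ->
  forall t, b <= t <= T ->
    y t = taylor_poly b T (caputo_order alpha) y t + kappa * rlint alpha b F t.
Proof.
move=> a0; have [n [mE am mb]] := caputo_orderS a0.
have [c c0 cI] := iter_rlint1E (R := R) n.
set beta := n.+1%:R - alpha in mb.
have beta0 : 0 <= beta by rewrite subr_ge0.
pose kappa := if beta == 0 then c else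
  c * Beta (1 - beta) n.+1%:R / Beta 1 alpha * Gamma beta / Beta (1 - beta) beta.
have kappa0 : 0 < kappa.
  rewrite /kappa; case: eqVneq => // bN.
  have bp : 0 < beta by rewrite lt_neqAle eq_sym bN.
  have b1 : 0 < 1 - beta by rewrite subr_gt0.
  by rewrite !(divr_gt0, mulr_gt0) ?Beta_gt0// Gamma_gt0// ltW.
exists kappa => // b T y F bT cF; rewrite mE /= => Cy Dy t /andP[bt tT].
pose g s := y s - (taylor_pol b T n y).[s - b].
(* The semigroup law is stated for functions continuous on the line. *)
pose gc := g \o clamp b T.
have gcE s : b <= s <= T -> gc s = g s by move=> h; rewrite /gc/= clamp_id.
have gb : g b = 0.
  by rewrite /g subrr horner_coef0 coef_poly /= fact0 divr1 subrr.
have cg : continuous gc.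
  apply: continuous_comp_clamp; first exact: ltW.
  apply: (@within_continuousB _ _ R^o); first exact: (Cn_on_continuous Cy).
  by apply: continuous_subspaceT; exact: continuous_horner_shift.
have fg : flat n b gc.
  move=> e e0; have := taylor_flat bT Cy e0; apply: filter_app; near=> s.
  rewrite gcE//; apply/andP; split; apply: ltW; near: s; first exact: nbhs_right_gt.
  exact: nbhs_right_lt.
suff: gc t = kappa * rlint alpha b F t.
  by rewrite gcE ?bt// /g taylor_polyE => <-; rewrite addrC subrK.
pose w := caputo_primitive alpha b T y.
have wE s : b <= s <= T -> w s =
    if beta == 0 then gc s else (Gamma beta)^-1 * rlint beta b gc s.
  move=> /andP[bs sT].
  rewrite /w /caputo_primitive mE -/beta /riemann_liouville.
  case: ifP => _; first by rewrite gcE ?bs// taylor_polyE.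
  congr (_ * _); apply: eq_Rintegral => r; rewrite inE/= in_itv/= => /andP[br rs].
  by rewrite gcE ?br ?(le_trans rs)// taylor_polyE.
have dw k s : (k < n.+1)%N -> s \in `]b, T] ->
    derivable_within `[b, T] (derive_within_n `[b, T] k w) s.
  by move=> kn /Dy[+ _]; apply; rewrite mE.
have wF s : s \in `]b, T] -> derive_within_n `[b, T] n.+1 w s = F s.
  by move=> /Dy[_]; rewrite /caputo mE.
have fw : flat n b w.
  have : flat n b (fun s => if beta == 0 then gc s
      else (Gamma beta)^-1 * rlint beta b gc s).
    case: eqVneq => // bN.
    apply: flatZ; apply: flat_rlint => //; first by rewrite lt_neqAle eq_sym bN.
    by rewrite gcE ?gb// lexx ltW.
  move=> + e e0 => /(_ e e0); apply: filter_app; near=> s.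
  rewrite wE//; apply/andP; split; apply: ltW; near: s; first exact: nbhs_right_gt.
  exact: nbhs_right_lt.
have W s : b <= s <= T -> w s = c * rlint n.+1%:R b F s.
  move=> /andP[]; rewrite le_eqVlt => /predU1P[<- _|bs sT].
    rewrite wE ?lexx ?ltW// !rlint0// !mulr0; case: ifP => //.
    by rewrite gcE ?gb// lexx ltW.
  by rewrite -cI// (flat_antiderivative bT cF dw wF fw)// in_itv/= bs.
move: wE; rewrite /kappa; case: eqVneq => [b0|bN] wE.
  have -> : alpha = n.+1%:R by apply/esym/eqP; rewrite -subr_eq0; apply/eqP.
  by rewrite -wE ?W ?bt.
have bp : 0 < beta by rewrite lt_neqAle eq_sym bN.
have b1 : 0 < 1 - beta by rewrite subr_gt0.
have G0 : 0 < Gamma beta by rewrite Gamma_gt0// ltW.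
have m0 : 0 < n.+1%:R :> R by rewrite ltr0n.
set k := _ / Beta (1 - beta) beta.
pose G s := gc s - k * rlint alpha b F s.
suff G0' : b < t -> gc t - k * rlint alpha b F t = 0.
  move: bt; rewrite le_eqVlt => /predU1P[<-|/G0'/eqP]; last first.
    by rewrite subr_eq0 => /eqP.
  by rewrite rlint0// mulr0 gcE ?gb// lexx ltW.
move=> bt'; apply: (@rlint1_eq0 _ b T G bT _ _ t); last by rewrite bt'.
- move=> x; apply: cvgB; first exact: cg.
  by apply: cvgMr; exact: continuous_rlint.
- move=> s /andP[bs sT].
  have B1 : Beta (1 - beta) beta != 0 by rewrite gt_eqF ?Beta_gt0.
  have B2 : Beta 1 alpha != 0 by rewrite gt_eqF ?Beta_gt0.
  have e1 : rlint (1 - beta) b (rlint beta b gc) s =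
      Beta (1 - beta) beta * rlint 1 b gc s.
    by rewrite (rlint_semigroup b s b1 bp cg) subrK.
  have e2 : rlint (1 - beta) b (rlint n.+1%:R b F) s =
      Beta (1 - beta) n.+1%:R * rlint (1 + alpha) b F s.
    rewrite (rlint_semigroup b s b1 m0 cF).
    by rewrite (_ : 1 - beta + n.+1%:R = 1 + alpha) // /beta; ring.
  have e3 : rlint 1 b (rlint alpha b F) s = Beta 1 alpha * rlint (1 + alpha) b F s.
    exact: (rlint_semigroup b s ltr01 a0 cF).
  have e4 : rlint (1 - beta) b (rlint beta b gc) s =
      Gamma beta * c * rlint (1 - beta) b (rlint n.+1%:R b F) s.
    rewrite -rlintZ//; last exact: continuous_rlint.
    apply: eq_rlint => r /andP[br rs].
    have rT : b <= r <= T by rewrite br (le_trans rs).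
    by rewrite -mulrA -W// wE// mulrA divff ?mul1r// gt_eqF.
  rewrite /G rlintB//; last by move=> x; apply: cvgMr; exact: continuous_rlint.
  rewrite rlintZ//; last exact: continuous_rlint.
  have {}e1 : rlint 1 b gc s =
      rlint (1 - beta) b (rlint beta b gc) s / Beta (1 - beta) beta.
    by rewrite e1 mulrC mulKf.
  rewrite e1 e4 e2 e3 /k.
  set rF := rlint (1 + alpha) b F s; set B3 := Beta (1 - beta) n.+1%:R.
  set B4 := Beta 1 alpha in B2 *; set B5 := Beta (1 - beta) beta in B1 *.
  by field; rewrite B1.
Unshelve. all: by end_near. Qed.

End CaputoVolterra.

(** * A Gronwall inequality with singular kernel *)

Section Gronwall.
Context {R : realType}.
Local Notation mu := (@lebesgue_measure R).

Lemma le_rlint (p b t : R) (F G : R -> R) : 0 < p -> continuous F -> continuous G ->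
  (forall s, b <= s <= t -> F s <= G s) -> rlint p b F t <= rlint p b G t.
Proof.
move=> p0 cF cG FG; apply: le_Rintegral => //; [exact: integrable_rlint_cont..|].
by move=> s /=; rewrite in_itv/= => /FG ?; rewrite ler_wpM2l// powR_ge0.
Qed.

Lemma continuous_expR_comp (g : R -> R) : continuous g ->
  continuous (fun s => expR (g s)).
Proof. by move=> cg s; apply: continuous_comp; [exact: cg|exact: continuous_expR]. Qed.

Lemma continuous_expR_cstB (c t : R) : continuous (fun s : R => expR (c * (t - s))).
Proof.
apply: continuous_expR_comp => s.
by apply: cvgMr; apply: cvgB; [exact: cvg_cst|exact: cvg_id].
Qed.

Lemma powR_le_expR (x theta : R) : 0 <= x -> 0 <= theta <= 1 ->
  x `^ theta <= expR x.
Proof.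
move=> x0 /andP[th0 th1]; apply: le_trans (expR_ge1Dx x).
have [x1|x1] := leP x 1.
  have : x `^ theta <= 1 `^ theta by rewrite ge0_ler_powR// nnegrE.
  by rewrite powR1 => /le_trans; apply; rewrite lerDl.
by rewrite (le_trans (ler1_powR (ltW x1) th1))// lerDr.
Qed.

(** With theta = min(alpha, 1) / 2 one has x^theta <= exp x for x >= 0, hence
u^(alpha-1) exp(-lambda u) <= lambda^(-theta) u^(alpha-theta-1), whose integral
is finite because theta < alpha and tends to 0 as lambda grows. *)
Lemma rlint_expR_small (alpha H eps : R) : 0 < alpha -> 0 < H -> 0 < eps ->
  exists2 lam : R, 0 < lam & forall b t : R, b <= t <= b + H ->
    rlint alpha b (fun s => expR (- lam * (t - s))) t <= eps.
Proof.
move=> a0 H0 e0.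
(* Half of min(alpha, 1) is both below alpha and at most 1. *)
pose th : R := Num.min alpha 1 / 2.
have th0 : 0 < th by rewrite divr_gt0// lt_min a0 ltr01.
have th1 : 0 <= th <= 1.
  rewrite ltW//= ler_pdivrMr// mul1r.
  by apply: (@le_trans _ _ 1); [rewrite ge_min lexx orbT|rewrite ler1n].
have ath : 0 < alpha - th.
  rewrite subr_gt0 ltr_pdivrMr//; apply: (@le_lt_trans _ _ alpha).
    by rewrite ge_min lexx.
  by rewrite ltr_pMr// ltr1n.
pose K := H `^ (alpha - th) / (alpha - th).
have K0 : 0 < K by rewrite divr_gt0// powR_gt0.
(* Solves lam^(- th) K = eps. *)
pose lam := (K / eps) `^ (th^-1).
have l0 : 0 < lam by rewrite powR_gt0// divr_gt0.
have lE : lam `^ (- th) = eps / K.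
  by rewrite /lam -powRrM mulrN mulVf ?gt_eqF// powR_inv1 ?invf_div// ltW// divr_gt0.
exists lam => // b t /andP[bt tH].
have cE : continuous (fun s : R => expR (- lam * (t - s))).
  exact: continuous_expR_cstB.
have sub : (`[b, t[%classic : set R) `<=` `[b, t]%classic.
  by apply: subset_itvl; rewrite bnd_simp.
have iE := integrable_rlint_cont b t a0 cE.
have iE' : mu.-integrable `[b, t[ (EFin \o
    (fun s : R => (t - s) `^ (alpha - 1) * expR (- lam * (t - s)))).
  by move: iE; apply: integrableS.
have ik := integrable_kernel b t ath.
have ik' : mu.-integrable `[b, t] (EFin \o
    (fun s : R => eps / K * (t - s) `^ (alpha - th - 1))).
  exact: (integrableZl _ _ ik).
have ik'' : mu.-integrable `[b, t[ (EFin \o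
    (fun s : R => eps / K * (t - s) `^ (alpha - th - 1))).
  by move: ik'; apply: integrableS.
(* At s = t the kernel takes the value 0^(alpha-1), which is 1 for alpha = 1;
   the comparison of the integrands is made off this point. *)
rewrite /rlint -Rintegral_itv_bndo_bndc//.
apply: (@le_trans _ _
    (\int[mu]_(s in `[b, t[) (eps / K * (t - s) `^ (alpha - th - 1)))).
  apply: le_Rintegral => // s /=; rewrite in_itv/= => /andP[bs st].
  have u0 : 0 < t - s by rewrite subr_gt0.
  have uN : t - s != 0 by rewrite gt_eqF.
  rewrite -lE addrAC [X in _ <= _ * X]powRD ?uN ?implybT// mulrCA ler_wpM2l ?powR_ge0//.
  rewrite -powRM ?(ltW l0) ?(ltW u0)// mulNr expRN powRN.
  rewrite lef_pV2 ?posrE ?expR_gt0 ?powR_gt0 ?mulr_gt0//.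
  by rewrite powR_le_expR// mulr_ge0// ltW.
rewrite Rintegral_itv_bndo_bndc// RintegralZl//.
rewrite [X in _ * X](_ : _ = (t - b) `^ (alpha - th) / (alpha - th)); last first.
  by rewrite /Rintegral integral_kernel.
rewrite mulrAC ler_pdivrMr// ler_pM2l// ler_pM2r ?invr_gt0//.
by rewrite (ge0_ler_powR (ltW ath)) ?nnegrE ?subr_ge0 ?(ltW H0)// lerBlDl.
Qed.

(** Let N be the maximum of exp(-lambda (s - b)) E(s), attained at c.  Inserting
E(s) <= N exp(lambda (s - b)) into the hypothesis at t = c gives N <= A + N/2
once lambda makes the weighted kernel integral at most 1 / (2 (D + 1)). *)
Lemma gronwall (alpha D H : R) : 0 < alpha -> 0 <= D -> 0 < H ->
  exists2 C : R, 0 <= C & forall (b T A : R) (E : R -> R), b <= T <= b + H ->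
    continuous E -> (forall t : R, 0 <= E t) ->
    (forall t : R, b <= t <= T -> E t <= A + D * rlint alpha b E t) ->
    forall t : R, b <= t <= T -> E t <= C * A.
Proof.
move=> a0 D0 H0.
have D1 : 0 < D + 1 by rewrite ltr_wpDl.
have e0 : 0 < (2 * (D + 1))^-1 by rewrite invr_gt0 mulr_gt0.
have [lam l0 lamP] := rlint_expR_small a0 H0 e0.
exists (2 * expR (lam * H)); first by rewrite mulr_ge0// expR_ge0.
move=> b T A E /andP[bT TH] cE E0 EA t /andP[bt tT].
pose phi s := expR (- lam * (s - b)) * E s.
have cexp : continuous (fun s : R => expR (- lam * (s - b))).
  apply: continuous_expR_comp => r.
  by apply: cvgMr; apply: cvgB; [exact: cvg_id|exact: cvg_cst].
have cphi : continuous phi by move=> s; apply: cvgM; [exact: cexp|exact: cE].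
have [c] := EVT_max bT (continuous_subspaceT cphi).
rewrite in_itv/= => /andP[bc cT] phic.
set N := phi c in phic.
have N0 : 0 <= N by rewrite mulr_ge0// expR_ge0.
have EN s : b <= s <= T -> E s <= N * expR (lam * (s - b)).
  move=> sI; have := phic s; rewrite in_itv/= sI => /(_ isT).
  by rewrite /phi mulNr expRN mulrC ler_pdivrMr ?expR_gt0.
have Nle : N <= 2 * A.
  have I1 : rlint alpha b E c <= N * expR (lam * (c - b)) * (2 * (D + 1))^-1.
    apply: (@le_trans _ _ (rlint alpha b (fun s =>
        N * expR (lam * (c - b)) * expR (- lam * (c - s))) c)).
      apply: le_rlint => //.
        by move=> s; apply: cvgMr; exact: continuous_expR_cstB.
      move=> s /andP[bs sc]; rewrite -mulrA -expRD.
      rewrite (_ : _ + _ = lam * (s - b)); last by ring.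
      by apply: EN; rewrite bs (le_trans sc).
    rewrite rlintZ//; last exact: continuous_expR_cstB.
    rewrite ler_wpM2l ?mulr_ge0 ?expR_ge0//.
    by apply: lamP; rewrite bc (le_trans cT).
  have : E c <= A + D * (N * expR (lam * (c - b)) * (2 * (D + 1))^-1).
    by rewrite (le_trans (EA c _)) ?bc// lerD2l ler_wpM2l.
  set x := expR (lam * (c - b)).
  have x1 : 1 <= x by rewrite -expR0 ler_expR mulr_ge0 ?subr_ge0// ltW.
  have x0 : 0 < x by exact: lt_le_trans x1.
  have -> : E c = N * x.
    by rewrite /N /phi mulNr expRN mulrAC mulVf ?mul1r// gt_eqF.
  have -> : D * (N * x * (2 * (D + 1))^-1) = (N * x / 2) * (D / (D + 1)).
    by field; rewrite gt_eqF.
  have DD : D / (D + 1) <= 1 by rewrite ler_pdivrMr// mul1r lerDl.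
  have Nx0 : 0 <= N * x by rewrite mulr_ge0// ltW.
  move=> h; have {}h : N * x <= 2 * A.
    have : N * x <= A + N * x / 2.
      by rewrite (le_trans h)// lerD2l ler_piMr// divr_ge0.
    lra.
  by rewrite (le_trans _ h)// ler_peMr.
have A0 : 0 <= A by have := le_trans N0 Nle; rewrite pmulr_rge0.
rewrite (le_trans (EN t _)) ?bt//.
rewrite [leRHS]mulrAC ler_pM ?expR_ge0// ler_expR ler_pM2l//.
by rewrite lerBlDl (le_trans tT).
Qed.

End Gronwall.

(** * Dependence on the starting point *)

Section Perturbation.
Context {R : realType}.
Local Notation mu := (@lebesgue_measure R).

Lemma rlint_split (p a a' t : R) (F : R -> R) : 0 < p -> continuous F ->
  a <= a' <= t ->
  rlint p a F t - rlint p a' F t =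
  \int[mu]_(s in `[a, a'[) ((t - s) `^ (p - 1) * F s).
Proof.
move=> p0 cF /andP[aa' a't].
have ia := integrable_rlint_cont a t p0 cF.
have ia' := integrable_rlint_cont a' t p0 cF.
have sub1 : (`[a, a'[%classic : set R) `<=` `[a, t]%classic.
  by apply: subset_itvl; rewrite bnd_simp.
have sub2 : (`]a', t]%classic : set R) `<=` `[a', t]%classic.
  by apply: subset_itvr; rewrite bnd_simp.
rewrite Rintegral_itv_bndo_bndc; last by move: ia; apply: integrableS.
rewrite [X in _ - X](_ : _ =
    \int[mu]_(s in `]a', t]) ((t - s) `^ (p - 1) * F s)); last first.
  by rewrite Rintegral_itv_obnd_cbnd//; move: ia'; apply: integrableS.
by rewrite -(Rintegral_itvB ia) ?bnd_simp// opprB addrC subrK.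
Qed.

(** For alpha <= 1 the power is decreasing and x may be replaced by y; for
alpha > 1 it is bounded by its value at H.  The sum of the two constants covers
both cases. *)
Lemma kernel_le (alpha H x y : R) : 0 < alpha -> 0 < y -> y <= x -> x <= H ->
  x `^ (alpha - 1) <= (1 + H `^ (alpha - 1)) * y `^ (Num.min alpha 1 - 1).
Proof.
move=> a0 y0 yx xH; have x0 : 0 < x by exact: lt_le_trans yx.
have [a1|a1] := leP alpha 1.
  apply: (@le_trans _ _ (y `^ (alpha - 1))).
    rewrite -(opprB 1) !powRN lef_pV2 ?posrE ?powR_gt0//.
    by rewrite ge0_ler_powR ?nnegrE ?subr_ge0// ltW.
  by rewrite ler_peMl ?powR_ge0// lerDl powR_ge0.
rewrite subrr powRr0 mulr1; apply: (@le_trans _ _ (H `^ (alpha - 1))).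
  rewrite ge0_ler_powR ?nnegrE ?subr_ge0 ?(ltW a1)// ?(ltW x0)//.
  by rewrite (le_trans (ltW x0)).
by rewrite lerDr.
Qed.

(** The difference is the integral over [a, a'), where (t - s)^(alpha-1) is at
most a constant times (a' - s)^(min(alpha, 1) - 1) by [kernel_le]; the latter
is integrated exactly. *)
Lemma rlint_start_diff (alpha H M a a' t : R) (F : R -> R) : 0 < alpha ->
  0 <= M -> continuous F -> a <= a' <= t -> t <= a + H ->
  (forall s, a <= s <= a' -> `|F s| <= M) ->
  `|rlint alpha a F t - rlint alpha a' F t| <=
    M * (1 + H `^ (alpha - 1)) / Num.min alpha 1 * (a' - a) `^ Num.min alpha 1.
Proof.
move=> a0 M0 cF aat tH FM; rewrite rlint_split//.
move: aat => /andP[aa' a't].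
set m := Num.min alpha 1.
have m0 : 0 < m by rewrite lt_min a0 ltr01.
set K := 1 + _.
have sub1 : (`[a, a'[%classic : set R) `<=` `[a, t]%classic.
  by apply: subset_itvl; rewrite bnd_simp.
have sub2 : (`[a, a'[%classic : set R) `<=` `[a, a']%classic.
  by apply: subset_itvl; rewrite bnd_simp.
have iF : mu.-integrable `[a, a'[ (EFin \o
    (fun s : R => (t - s) `^ (alpha - 1) * F s)).
  by move: (integrable_rlint_cont a t a0 cF); apply: integrableS.
have ik := integrable_kernel a a' m0.
have iMk : mu.-integrable `[a, a'] (EFin \o
    (fun s : R => M * K * (a' - s) `^ (m - 1))).
  exact: (integrableZl _ _ ik).
have iMk' : mu.-integrable `[a, a'[ (EFin \o
    (fun s : R => M * K * (a' - s) `^ (m - 1))).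
  by move: iMk; apply: integrableS.
apply: le_trans (le_normr_Rintegral _ iF) _ => //.
apply: (@le_trans _ _ (\int[mu]_(s in `[a, a'[) (M * K * (a' - s) `^ (m - 1)))).
  apply: le_Rintegral => //; first exact: integrable_norm.
  move=> s /=; rewrite in_itv/= => /andP[as_ sa'].
  rewrite normrM ger0_norm ?powR_ge0// mulrC -mulrA ler_pM ?powR_ge0//.
    by rewrite FM// as_ ltW.
  apply: kernel_le => //; first by rewrite subr_gt0.
    by rewrite lerD2r.
  by rewrite lerBlDl (le_trans tH)// lerD2r.
rewrite Rintegral_itv_bndo_bndc// RintegralZl//.
rewrite [X in _ * X](_ : _ = (a' - a) `^ m / m); last first.
  by rewrite /Rintegral integral_kernel.
by rewrite [in leRHS]mulrAC mulrA.
Qed.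

Lemma dist_expr (u v H : R) (k : nat) : 0 <= u <= H -> 0 <= v <= H ->
  `|u ^+ k - v ^+ k| <= k%:R * (1 + H) ^+ k * `|u - v|.
Proof.
move=> /andP[u0 uH] /andP[v0 vH].
have H0 : 0 <= H by exact: le_trans uH.
rewrite subrXX normrM mulrC ler_wpM2r//.
apply: le_trans (ler_norm_sum _ _ _) _.
rewrite mulrC mulr_natr -[in leRHS](card_ord k) -sumr_const.
apply: ler_sum => i _; rewrite normrM !normrX !ger0_norm//.
have le1 (j : nat) (w : R) : 0 <= w -> w <= H -> w ^+ j <= (1 + H) ^+ j.
  by move=> w0 wH; rewrite lerXn2r ?nnegrE ?addr_ge0// (le_trans wH)// lerDr.
apply: (@le_trans _ _ ((1 + H) ^+ (k.-1 - i) * (1 + H) ^+ i)).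
  by rewrite ler_pM ?exprn_ge0// le1.
rewrite -exprD ler_weXn2l ?lerDl//.
rewrite card_ord subnK; first exact: leq_pred.
by rewrite -ltnS prednK// (leq_trans _ (ltn_ord i)).
Qed.

Lemma poly_start_diff (m : nat) (c : 'I_m -> R) (H : R) : 0 <= H ->
  exists2 C : R, 0 <= C & forall a a' t : R, a <= a' <= t -> t <= a + H ->
    `|\sum_(k < m) c k * (t - a) ^+ k - \sum_(k < m) c k * (t - a') ^+ k|
      <= C * (a' - a).
Proof.
move=> H0.
exists (\sum_(k < m) `|c k| * (k%:R * (1 + H) ^+ k)).
  by apply: sumr_ge0 => k _; rewrite !mulr_ge0 ?exprn_ge0 ?addr_ge0.
move=> a a' t /andP[aa' a't] tH.
rewrite -sumrB (le_trans (ler_norm_sum _ _ _))// mulr_suml.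
apply: ler_sum => k _; rewrite -mulrBr normrM -mulrA ler_wpM2l//.
have -> : a' - a = `|(t - a) - (t - a')|.
  by rewrite (_ : t - a - (t - a') = a' - a) ?ger0_norm ?subr_ge0//; ring.
apply: dist_expr; apply/andP; split.
- by rewrite subr_ge0 (le_trans aa').
- by rewrite lerBlDl.
- by rewrite subr_ge0.
- by rewrite lerBlDl (le_trans tH)// lerD2r.
Qed.

(** As min(alpha, 1) <= 1, the linear terms are absorbed in the power. *)
Lemma le_powR_min1 (alpha H d : R) : 0 < alpha -> 0 <= d <= H ->
  d <= (1 + H) * d `^ Num.min alpha 1.
Proof.
move=> a0 /andP[d0 dH].
set m := Num.min alpha 1.
have m1 : 0 <= 1 - m by rewrite subr_ge0 ge_min lexx orbT.
have H0 : 0 <= H by exact: le_trans dH.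
have [->|dN] := eqVneq d 0.
  by rewrite mulr_ge0 ?powR_ge0// addr_ge0.
have dE : d = d `^ (1 - m) * d `^ m.
  by rewrite -powRD ?dN ?implybT// subrK powRr1.
rewrite {1}dE.
rewrite ler_wpM2r ?powR_ge0//.
apply: (@le_trans _ _ ((1 + H) `^ (1 - m))).
  by rewrite (ge0_ler_powR m1) ?nnegrE ?addr_ge0// (le_trans dH)// lerDr.
rewrite ler1_powR ?lerDl// gerBl; apply: ltW; by rewrite lt_min a0 ltr01.
Qed.

End Perturbation.

Theorem theorem2p1 (R : realType) (alpha a T : R)
    (y0 : 'I_(caputo_order alpha) -> R) (f : R -> R -> R)
    (halpha : 0 < alpha) (haT : a < T)
    (fcont : {within `[a, T] `*` [set: R],
                continuous (fun p : R * R => f p.1 p.2)})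
    (fbounded : exists M : R, forall t u : R, t \in `[a, T] -> `|f t u| <= M)
    (flipschitz : exists2 L : R, 0 <= L &
       forall t u v : R, t \in `[a, T] -> `|f t u - f t v| <= L * `|u - v|) :
  exists C : R, forall y : R -> R, caputo_ivp_solution f y0 a T y ->
    forall (a' : R) (y' : R -> R), a <= a' -> a' < T ->
      caputo_ivp_solution f y0 a' T y' ->
      (ereal_sup [set `|y t - y' t|%:E | t in `[a', T]]
         <= (C * `|a - a'| `^ Num.min alpha 1)%:E)%E.
Proof.
have [M fM] := fbounded; have [L L0 fL] := flipschitz.
have M0 : 0 <= M.
  by apply: le_trans (fM a 0 _) => //; rewrite in_itv/= lexx ltW.
have [kappa k0 V] := caputo_volterra halpha.
have H0 : 0 < T - a by rewrite subr_gt0.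
have [Cg Cg0 G] := gronwall halpha (mulr_ge0 (ltW k0) L0) H0.
have [Cp Cp0 P] := poly_start_diff (fun k => y0 k / k`!%:R) (ltW H0).
set m := Num.min alpha 1.
pose Ck := kappa * (M * (1 + (T - a) `^ (alpha - 1)) / m).
exists (Cg * (Cp * (1 + (T - a)) + Ck)) => y [Cy iy ey] a' y' aa' a'T [Cy' iy' ey'].
have Fcont (c : R) (z : R -> R) : a <= c -> c < T ->
    {within `[c, T], continuous z} ->
    continuous (fun s => f (clamp c T s) (z (clamp c T s))).
  move=> ac cT cz.
  have phic : continuous (fun s => (clamp c T s, z (clamp c T s)) : R * R).
    move=> s; have c1 : clamp c T x @[x --> s] --> clamp c T s.
      exact: continuous_clamp.
    have c2 : z (clamp c T x) @[x --> s] --> z (clamp c T s).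
      exact: (continuous_comp_clamp (ltW cT) cz).
    exact: (cvg_pair c1 c2).
  apply: (continuous_comp_within phic _ fcont) => s; split => //=.
  have := clamp_itv s (ltW cT); rewrite !in_itv/= => /andP[cs ->].
  by rewrite (le_trans ac).
pose F s := f (clamp a T s) (y (clamp a T s)).
pose F' s := f (clamp a' T s) (y' (clamp a' T s)).
have cy := Cn_on_continuous Cy; have cy' := Cn_on_continuous Cy'.
have cF : continuous F by exact: Fcont.
have cF' : continuous F' by exact: Fcont.
have yE t : a <= t <= T -> y t = \sum_(k < caputo_order alpha)
    y0 k / k`!%:R * (t - a) ^+ k + kappa * rlint alpha a F t.
  move=> tI; rewrite (V a T y F haT cF Cy _ t tI).
    by congr (_ + _); apply: eq_bigr => k _; rewrite iy.
  move=> s sI; have [? ->] := ey s sI; split => //.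
  by move: sI; rewrite in_itv/= => /andP[/ltW as_ sT]; rewrite /F clamp_id ?as_.
have yE' t : a' <= t <= T -> y' t = \sum_(k < caputo_order alpha)
    y0 k / k`!%:R * (t - a') ^+ k + kappa * rlint alpha a' F' t.
  move=> tI; rewrite (V a' T y' F' a'T cF' Cy' _ t tI).
    by congr (_ + _); apply: eq_bigr => k _; rewrite iy'.
  move=> s sI; have [? ->] := ey' s sI; split => //.
  by move: sI; rewrite in_itv/= => /andP[/ltW as_ sT]; rewrite /F' clamp_id ?as_.
pose E s := `|y (clamp a' T s) - y' (clamp a' T s)|.
have cE : continuous E.
  move=> s; apply: cvg_norm; apply: cvgB.
    have cya' : {within `[a', T], continuous y}.
      apply: continuous_subspaceW cy => x /=; rewrite !in_itv/= => /andP[a'x ->].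
      by rewrite (le_trans aa').
    exact: (continuous_comp_clamp (ltW a'T) cya').
  exact: (continuous_comp_clamp (ltW a'T) cy').
have EE s : a' <= s <= T -> E s = `|y s - y' s| by move=> sI; rewrite /E clamp_id.
rewrite -normrN opprB (ger0_norm (x := a' - a)) ?subr_ge0//.
set d := (a' - a) `^ m.
have a'TH : a' <= T <= a' + (T - a).
  by rewrite (ltW a'T)/= addrCA -lerBlDl subrr subr_ge0.
apply: ge_ereal_sup => _ [t /= + <-]; rewrite in_itv/= => tI.
rewrite lee_fin -EE// -mulrA.
have E0 s : 0 <= E s by exact: normr_ge0.
apply: (G a' T _ E a'TH cE E0) tI => {}t /andP[a't tT].
have aat : a <= a' <= t by rewrite aa'.
have tH : t <= a + (T - a) by rewrite addrC subrK.
rewrite EE ?a't// yE ?yE' ?a't// ?(le_trans aa')//.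
have h1 := P _ _ _ aat tH.
have h1' : Cp * (a' - a) <= Cp * (1 + (T - a)) * d.
  rewrite -mulrA ler_wpM2l// le_powR_min1// subr_ge0 aa'/=.
  by rewrite lerD2r ltW.
have FM s : a <= s <= a' -> `|F s| <= M.
  by move=> _; apply: fM; exact: clamp_itv (ltW haT).
have h2 := rlint_start_diff halpha M0 cF aat tH FM.
rewrite -/m -/d in h2.
have h3 : `|rlint alpha a' F t - rlint alpha a' F' t| <= L * rlint alpha a' E t.
  rewrite -rlintB// -rlintZ//.
  have cFF : continuous (fun s => F s - F' s).
    by move=> s; apply: cvgB; [exact: cF|exact: cF'].
  have cLE : continuous (fun s => L * E s) by move=> s; apply: cvgMr; exact: cE.
  have FE s : a' <= s <= t -> `|F s - F' s| <= L * E s.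
    move=> /andP[a's st]; have sT := le_trans st tT.
    have as_ := le_trans aa' a's.
    rewrite /F /F' /E !clamp_id ?a's ?as_ ?sT//; apply: fL.
    by rewrite in_itv/= as_.
  rewrite ler_norml; apply/andP; split; last first.
    by apply: le_rlint => // s /FE; exact/le_trans/ler_norm.
  rewrite lerNl -mulN1r -rlintZ//.
  apply: le_rlint => //; first by move=> s; apply: cvgMr; exact: cFF.
  by move=> s /FE; rewrite mulN1r -normrN; exact/le_trans/ler_norm.
set S1 := \sum_(k < _) _ in h1 *; set S2 := \sum_(k < _) _ in h1 *.
(* The Taylor polynomials, the integral over [a, a'), the integrals over [a', t]. *)
rewrite (_ : _ - _ = (S1 - S2) + (kappa * (rlint alpha a F t - rlint alpha a' F t) +
   kappa * (rlint alpha a' F t - rlint alpha a' F' t))); last by ring.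
apply: (le_trans (ler_normD _ _)).
rewrite mulrDl -addrA; apply: lerD; first exact: le_trans h1'.
apply: (le_trans (ler_normD _ _)).
rewrite !normrM (ger0_norm (ltW k0)) /Ck -[in leRHS]mulrA -(mulrA kappa L).
by apply: lerD; rewrite ler_wpM2l// ltW.
Qed.
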